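(* Let $X$ be a Peano continuum and let $f\colon X\to X$ be a cw-expansive homeomorphism. Then the stable and unstable cw-foliations $\mathcal F^s=\mathcal A^s$ and $\mathcal F^u=\mathcal A^u$ of $f$ are invariant cw-foliations without plaque-compact leaves. That is, for each $\sigma\in\{s,u\}$: $\mathcal U^\sigma$ is a complete basis of the topology of $X$; $\mathcal A^\sigma$ is an atlas over $\mathcal U^\sigma$ which is a cw-atlas; $\mathcal A^\sigma$ is invariant under $f$; and no leaf of $\mathcal A^\sigma$ is compact in the plaque topology.
   Context: A continuum is a compact connected metric space; a Peano continuum is a locally connected continuum. $f$ is cw-expansive if there is $\delta>0$ such that if $A\subset X$ is connected and $\operatorname{diam}(f^n(A))<\delta$ for all $n\in\mathbb Z$ then $A$ is a singleton. Atlases. Let $(X,\operatorname{dist})$ be a compact metric space with topology $\tau$. For $Y\subset X$ and $x\in Y$, $\operatorname{Comp}_x(Y)$ is the connected component of $Y$ containing $x$; $\mathcal C(Y)$ is the set of non-empty subcontinua of $Y$. A decomposition of a compact set $Y\subset X$ is a map $Q\colon Y\to\mathcal C(Y)$ with $x\in Q(x)$ for all $x$, any two values equal or disjoint, and upper semicontinuous: for all $x\in Y$ and every open $V\supset Q(x)$ there is a neighborhood $W$ of $x$ with $Q(y)\subset V$ for all $y\in W\cap Y$. If $Z\subset Y$, the monotone restriction is $Q|^m_Z(x)=\operatorname{Comp}_x(Q(x)\cap Z)$, $x\in Z$. Decompositions $Q_i$ of $Y_i$ ($i=1,2$) are compatible if $Q_1|^m_{Y_1\cap Y_2}=Q_2|^m_{Y_1\cap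 Y_2}$. An atlas over an open cover $\mathcal U$ of $X$ is a collection $\mathcal A=\{Q_{\overline U}\}_{U\in\mathcal U}$ of pairwise compatible decompositions $Q_{\overline U}$ of the closures $\overline U$. A basis $\mathcal U$ of $\tau$ is complete if $V\in\mathcal U$ and $U\subset V$ open imply $U\in\mathcal U$. Put $Q_U=Q_{\overline U}|^m_U$. For an atlas over a complete basis, the open plaques are the sets $Q_U(x)$ with $x\in U\in\mathcal U$; they form a basis of a topology on $X$, the plaque topology. The leaf of $x$ is the set of $y$ for which there are open plaques $P_1,\dots,P_n$ with $x\in P_1$, $y\in P_n$ and $P_i\cap P_{i+1}\ne\emptyset$ for $1\le i<n$. An atlas is a cw-atlas if (1) each leaf is a countable union of open plaques, (2) each leaf is a meagre subset of $(X,\tau)$, and (3) the diameters of the leaves are bounded away from zero. A cw-foliation is a maximal atlas with a cw-atlas; for the stable (unstable) cw-foliation, maximality is understood among the atlases all of whose plaques are stable (unstable) continua. A leaf is plaque-compact if it is compact in the plaque topology. Stable and unstable atlases. A continuum $C\subset X$ is stable if $\operatorname{diam}(f^n(C))\to0$ as $n\to+\infty$, and unstable if $\operatorname{diam}(f^n(C))\to 0$ as $n\to-\infty$. For closed $Y\subset X$ and $x\in Y$, $Q^s_Y(x)$ (resp. $Q^u_Y(x)$) is the set of $y\in Y$ such that some stable (resp. unstable) continuum $C\subset Y$ contains $x$ and $y$. Let $\mathcal U^s$ be the set of open $U\subset X$ such that $Q^s_{\overline U}$ is a decomposition of $\overline U$ all of whose values are stable continua, and $\mathcal A^s=\{Q^s_{\overline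 U}:U\in\mathcal U^s\}$; $\mathcal U^u,\mathcal A^u$ are defined analogously with unstable continua. An atlas $\mathcal A$ over $\mathcal U$ is invariant if for all $n\in\mathbb Z$ and $U\in\mathcal U$: $f^n(U)\in\mathcal U$ and $Q_{f^n(\overline U)}(f^n(x))=f^n(Q_{\overline U}(x))$ for all $x\in\overline U$.
   Formalization: The continuum X is assumed to have at least two points; for a one-point X the claim fails, since its only leaf is X itself, which is not meagre, has diameter zero and is plaque-compact. *)

(* Defs.v *)
From HB Require Import structures.
From mathcomp Require Import all_boot all_order all_algebra finmap.
From mathcomp Require Import all_classical all_reals all_analysis.

Set Implicit Arguments.
Unset Strict Implicit.
Unset Printing Implicit Defensive.
Import Order.TTheory GRing.Theory Num.Theory.
Import numFieldNormedType.Exports.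
Local Open Scope classical_set_scope.
Local Open Scope ring_scope.

Section topology_notions.
Variable T : topologicalType.
Implicit Types (A C U V : set T) (B : set (set T)).

Definition continuum C := [/\ C !=set0, compact C & connected C].

Definition locally_connected :=
  forall (x : T) U, nbhs x U ->
    exists V, [/\ open V, V x, connected V & V `<=` U].

Definition peano_continuum := continuum [set: T] /\ locally_connected.

Definition meagre A :=
  exists F : nat -> set T,
    (forall i, (closure (F i))° = set0) /\ A `<=` \bigcup_i F i.

Definition complete_basis B :=
  basis B /\ forall V U, B V -> open U -> U `<=` V -> B U.

End topology_notions.

Arguments locally_connected : clear implicits.
Arguments peano_continuum : clear implicits.

(* [sup] is 0 on unbounded sets; all uses are in a compact space, where every
   set of distances is bounded. *)
Definition diam (R : realType) (X : metricType R) (A : set X) : R :=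
  sup [set mdist p.1 p.2 | p in A `*` A].

(* A homeomorphism is given together with its inverse [g]. *)
Definition homeomorphism (X Y : topologicalType) (f : X -> Y) (g : Y -> X) :=
  [/\ continuous f, continuous g, cancel f g & cancel g f].

(* The n-th iterate of [f] for n in Z, where [g] is the inverse of [f]. *)
Definition iterz (X : Type) (f g : X -> X) (n : int) : X -> X :=
  match n with Posz k => iter k f | Negz k => iter k.+1 g end.

(* The empty set is connected for the library, hence [A !=set0]. *)
Definition cw_expansive (R : realType) (X : metricType R) (f g : X -> X) :=
  exists2 delta : R, 0 < delta &
    forall A : set X, A !=set0 -> connected A ->
      (forall n : int, diam (iterz f g n @` A) < delta) ->
      exists x, A = [set x].

Section atlases.
Variable T : topologicalType.

(* A decomposition Q of Y is a total function of which only the values at the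
   points of Y are relevant. *)
Definition decomposition (Y : set T) (Q : T -> set T) :=
  [/\ forall x, Y x -> continuum (Q x) /\ Q x `<=` Y,
      forall x, Y x -> Q x x,
      forall x y, Y x -> Y y -> Q x = Q y \/ Q x `&` Q y = set0
    & forall x V, Y x -> open V -> Q x `<=` V ->
        \forall y \near x, Y y -> Q y `<=` V].

Definition monotone_restriction (Q : T -> set T) (Z : set T) (x : T) : set T :=
  connected_component (Q x `&` Z) x.

Definition compatible (Y1 Y2 : set T) (Q1 Q2 : T -> set T) :=
  forall x, Y1 x -> Y2 x ->
    monotone_restriction Q1 (Y1 `&` Y2) x =
    monotone_restriction Q2 (Y1 `&` Y2) x.

(* An atlas over UU is a pair (UU, Q), where the family of decompositions is
   indexed by the closures: [Q (closure U)] decomposes [closure U] for U in UU,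
   and the other values of [Q] are irrelevant. *)
Implicit Types (UU : set (set T)) (Q : set T -> T -> set T) (K : set (set T)).

Definition atlas UU Q :=
  [/\ UU `<=` open, \bigcup_(U in UU) U = setT,
      forall U, UU U -> decomposition (closure U) (Q (closure U))
    & forall U V, UU U -> UU V ->
        compatible (closure U) (closure V) (Q (closure U)) (Q (closure V))].

Definition open_plaque UU Q : set (set T) :=
  [set P | exists U x,
     [/\ UU U, U x & P = monotone_restriction (Q (closure U)) U x]].

Definition leaf UU Q (x : T) : set T :=
  [set y | exists (n : nat) (P : nat -> set T),
     [/\ forall i, (i <= n)%N -> open_plaque UU Q (P i),
         P 0%N x, P n y
       & forall i, (i < n)%N -> P i `&` P i.+1 !=set0]].

(* Copy of T carrying the topology generated by the open plaques; see
   [open_plaque_spaceP] for the fact that they form a basis. *)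
Definition plaque_space UU Q : Type := T.

HB.instance Definition _ UU Q := Choice.on (plaque_space UU Q).
HB.instance Definition _ UU Q :=
  @isSubBaseTopological.Build (plaque_space UU Q) (set T) (open_plaque UU Q) id.

Definition plaque_compact UU Q (L : set T) :=
  compact (L : set (plaque_space UU Q)).

Definition plaques_in K UU Q :=
  forall U x, UU U -> closure U x -> K (Q (closure U) x).

Definition extends UU' Q' UU Q :=
  UU `<=` UU' /\
  forall U x, UU U -> closure U x -> Q' (closure U) x = Q (closure U) x.

Definition maximal_atlas K UU Q :=
  [/\ atlas UU Q, plaques_in K UU Q
    & forall UU' Q', atlas UU' Q' -> plaques_in K UU' Q' ->
        extends UU' Q' UU Q -> UU' = UU].

(* The atlas associated with a class K of continua. *)
Definition class_plaque K (Y : set T) (x : T) : set T :=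
  [set y | exists C, [/\ K C, C `<=` Y, C x & C y]].

Definition class_domain K : set (set T) :=
  [set U | [/\ open U, decomposition (closure U) (class_plaque K (closure U))
             & forall x, closure U x -> K (class_plaque K (closure U) x)]].

Definition invariant_atlas (f g : T -> T) UU Q :=
  forall (n : int) U, UU U ->
    UU (iterz f g n @` U) /\
    forall x, closure U x ->
      Q (iterz f g n @` closure U) (iterz f g n x) =
      iterz f g n @` Q (closure U) x.

Lemma open_plaque_basis UU Q P1 P2 z :
  atlas UU Q -> complete_basis UU ->
  open_plaque UU Q P1 -> open_plaque UU Q P2 -> P1 z -> P2 z ->
  exists P, [/\ open_plaque UU Q P, P z & P `<=` P1 `&` P2].
Proof.
move=> [opU cov dec comp] [_ cplt] [U [x [UUU Ux ->]]] [V [y [UUV Vy ->]]] Pz1 Pz2.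
pose W := U `&` V.
have key U' x' : UU U' -> U' x' -> W `<=` U' ->
    monotone_restriction (Q (closure U')) U' x' z ->
  [/\ UU W, W `<=` U', closure W z -> Q (closure W) z z
   & closure W z -> monotone_restriction (Q (closure W)) W z `<=`
     monotone_restriction (Q (closure U')) U' x'].
  move=> UU' U'x' WU' zP.
  have UUW : UU W by apply: (cplt _ _ UU') => //; apply: openI; exact: opU.
  split => //.
    by case: (dec _ UUW) => _ /(_ z).
  move=> Wz.
  have cWU := closureS WU'.
  have cUz := cWU _ Wz.
  have [Qz U'z] := connected_component_sub zP.
  have QE : Q (closure U') x' = Q (closure U') z.
    case: (dec _ UU') => _ refl eqd _.
    have [//|/seteqP[+ _]] := eqd _ _ (subset_closure U'x') cUz.
    by move=> /(_ z)[]; split => //; exact: refl.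
  have QWU : Q (closure W) z `<=` Q (closure U') z.
    have := comp _ _ UUW UU' z Wz cUz.
    rewrite /monotone_restriction (setIidl cWU).
    case: (dec _ UUW) => ctm refl _ _.
    have [[_ _ con] sub] := ctm _ Wz.
    rewrite (setIidl sub) connected_component_id //; last exact: refl.
    by move=> ->; move=> t /connected_component_sub[].
  apply: subset_trans (_ : connected_component (Q (closure U') x' `&` U') z `<=` _).
    move=> t [C [Cz CW cC] Ct]; exists C => //; split => //.
    by move=> s /CW[/QWU Qs /WU' Us]; rewrite QE.
  by move=> t; exact: connected_component_trans.
have [_ Uz] := connected_component_sub Pz1.
have [_ Vz] := connected_component_sub Pz2.
have Wz : W z by [].
have [UUW _ r s1] := key _ _ UUU Ux (@subIsetl _ _ _) Pz1.
have [_ _ _ s2] := key _ _ UUV Vy (@subIsetr _ _ _) Pz2.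
have cWz := subset_closure Wz.
exists (monotone_restriction (Q (closure W)) W z); split.
- by exists W, z.
- by apply: connected_component_refl; split => //; exact: r.
- by move=> t Pt; split; [exact: s1 Pt|exact: s2 Pt].
Qed.

Lemma open_plaque_spaceP UU Q (A : set (plaque_space UU Q)) :
  atlas UU Q -> complete_basis UU ->
  open A <-> forall x, A x ->
    exists P, [/\ open_plaque UU Q P, P x & P `<=` A].
Proof.
move=> at_ cb; split.
  move=> [D' sD <-] x [B D'B Bx].
  have [F' sF FE] := sD _ D'B.
  pose F : {fset (set T)} := F'.
  have : exists P, [/\ open_plaque UU Q P, P x & P `<=` B].
    have Fx : forall i : set T, i \in F -> i x.
      by move: Bx; rewrite -FE => Fx i iF; exact: Fx.
    have {}sF (i : set T) : i \in F -> open_plaque UU Q i.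
      by move=> /sF; rewrite inE.
    rewrite -FE.
    have [P [oP Px]] : exists P, open_plaque UU Q P /\ P x.
      case: at_ => _ cov dec _.
      have [U UUU Ux] : (\bigcup_(U in UU) U) x by rewrite cov.
      exists (monotone_restriction (Q (closure U)) U x); split.
        by exists U, x.
      apply: connected_component_refl; split => //.
      by case: (dec _ UUU) => _ + _ _; apply; exact: subset_closure.
    have : forall s : seq (set T), (forall i, i \in s -> open_plaque UU Q i /\ i x) ->
      exists P, [/\ open_plaque UU Q P, P x & forall i, i \in s -> P `<=` i].
      elim=> [_|i s IH si]; first by exists P; split.
      have [|P' [oP' P'x P's]] := IH.
        by move=> j js; apply: si; rewrite inE js orbT.
      have [oi ix] := si i (mem_head _ _).
      have [P'' [? ? s2]] := open_plaque_basis at_ cb oi oP' ix P'x.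
      exists P''; split => // j; rewrite inE => /orP[/eqP ->|js].
        by move=> t /s2[].
      by move=> t /s2[_]; exact: P's.
    move=> /(_ (enum_fset F))[i iF|P' [? ? PF]].
      by split; [exact: sF|exact: Fx].
    by exists P'; split => // t P't i iF; exact: PF P't.
  by move=> [P [? ? PB]]; exists P; split => // t /PB Bt; exists B.
move=> H.
have -> : A = \bigcup_(P in [set P | open_plaque UU Q P /\ P `<=` A]) P.
  apply/seteqP; split=> [x /H[P [? ? ?]]|x [P [_ PA] /PA //]].
  by exists P.
exists [set P | open_plaque UU Q P /\ P `<=` A] => //.
move=> P [oP _]; exists [fset (P : set T)]%fset.
  by move=> i /fset1P ->; rewrite inE.
by rewrite set_fset1 bigcap_set1.
Qed.

End atlases.

Section cw_foliations.
Variables (R : realType) (X : metricType R).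
Implicit Types (UU K : set (set X)) (Q : set X -> X -> set X).

Definition cw_atlas UU Q :=
  [/\ atlas UU Q,
      forall x, exists F : set (set X),
        [/\ countable F, F `<=` open_plaque UU Q
          & leaf UU Q x = \bigcup_(P in F) P],
      forall x, meagre (leaf UU Q x)
    & exists2 c : R, 0 < c & forall x, c <= diam (leaf UU Q x)].

(* K is the class of continua within which maximality is understood. *)
Definition cw_foliation K UU Q := cw_atlas UU Q /\ maximal_atlas K UU Q.

Definition stable (f g : X -> X) : set (set X) :=
  [set C | continuum C /\
     diam (iterz f g n%:Z @` C) @[n --> \oo] --> (0 : R)].

Definition unstable (f g : X -> X) : set (set X) :=
  [set C | continuum C /\
     diam (iterz f g (- n%:Z) @` C) @[n --> \oo] --> (0 : R)].

Definition stable_plaque f g := class_plaque (stable f g).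
Definition stable_domain f g := class_domain (stable f g).
Definition unstable_plaque f g := class_plaque (unstable f g).
Definition unstable_domain f g := class_domain (unstable f g).

End cw_foliations.

(* Main.v *)
Require Import Defs.
From mathcomp Require Import all_boot all_order all_algebra.
From mathcomp Require Import all_classical all_reals all_analysis.
From mathcomp Require Import lra zify.

(** The one compactness input is a uniform form of cw-expansiveness: a connected
    set whose iterates stay small during a long time window is tiny in the middle
    of it (otherwise a limit of such sets would be a nondegenerate continuum with
    all iterates small). Together with local connectedness it shows that connected
    sets which are tiny at both ends of an orbit segment are small all along it.
    Hence stable continua contained in a small closed set are uniformly stable,
    their union is again a stable continuum, and limits of them are stable: small
    open sets belong to the domain of the atlas.

    No nonempty open set is stable: backward orbits of its points would have stable
    neighborhoods of uniform size, so any two of its points would be recurrent along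
    common times while being forward asymptotic, and the open set would be a point.
    This makes stable continua nowhere dense; applied to the inverse it produces,
    by pulling back from an omega-limit point, stable continua of a fixed size
    through every point.

    A stable continuum eventually becomes small, so pulling back balls shows that it
    lies in a single plaque. Therefore a leaf is the union of the stable continua
    through a point, it is covered by countably many plaques, and the atlas is
    maximal. A plaque-compact leaf would be contained in one stable continuum, and
    its iterates would be arbitrarily small leaves. *)

Set Implicit Arguments.
Unset Strict Implicit.
Unset Printing Implicit Defensive.
Import Order.TTheory GRing.Theory Num.Theory.
Import numFieldNormedType.Exports.
Local Open Scope classical_set_scope.
Local Open Scope ring_scope.

(** * Connected sets and limits of continua *)

Section continua.
Variable T : topologicalType.

Lemma component_open (A : set T) x :
  locally_connected T -> open A -> open (connected_component A x).
Proof.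
move=> lcT oA; rewrite openE => y Ay.
have [V [oV Vy cV VA]] := lcT y A (open_nbhs_nbhs (conj oA (connected_component_sub Ay))).
apply: filterS (open_nbhs_nbhs (conj oV Vy)) => z Vz.
by apply: connected_component_trans Ay _; exists V.
Qed.

Lemma connected_between (A B : set T) :
  connected A -> A `<=` B -> B `<=` closure A -> connected B.
Proof.
move=> cA AB BA U U0 [C1 oC1 C1E] [C2 cC2 C2E].
have AU : A `<=` U.
  suff : A `&` C1 = A.
    by move=> AC1 a Aa; rewrite C1E; split; [exact: AB|move: Aa; rewrite -{1}AC1 => -[]].
  apply: cA.
  - move: U0; rewrite C1E => -[b [Bb C1b]].
    by have [a [Aa C1a]] := BA _ Bb _ (open_nbhs_nbhs (conj oC1 C1b)); exists a.
  - by exists C1.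
  - exists C2 => //; apply/seteqP; split=> a [Aa].
      move=> C1a; have : U a by rewrite C1E; split => //; exact: AB.
      by rewrite C2E => -[].
    move=> C2a; have : U a by rewrite C2E; split => //; exact: AB.
    by rewrite C1E => -[].
apply/seteqP; split=> [b|b Bb]; first by rewrite C2E => -[].
rewrite C2E; split=> //; rewrite (closure_id C2).1//.
apply: closureS (BA _ Bb) => a /AU; rewrite C2E => -[] //.
Qed.

(* The component of [p] in [V `&` O] cannot be relatively closed in [V]. *)
Lemma component_reaches_boundary (V O : set T) p :
  locally_connected T -> open V -> connected V -> open O -> V p -> O p ->
  ~ V `<=` O ->
  exists K z, [/\ connected K, K p, K `<=` V `&` O, closure K z & V z /\ ~ O z].
Proof.
move=> lcT oV cV oO Vp Op VO.
pose K := connected_component (V `&` O) p.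
have Kp : K p by apply: connected_component_refl.
have cK : connected K by exact: component_connected.
have KVO : K `<=` V `&` O by exact: connected_component_sub.
apply: contrapT => noz; apply: VO.
suff : K = V by move=> <- x /KVO[].
apply: cV; first by exists p.
  exists K; first exact: component_open (openI oV oO).
  by apply/seteqP; split=> x; [move=> Kx; split=> //; case: (KVO _ Kx)|case].
exists (closure K); first exact: closed_closure.
apply/seteqP; split=> x; first by move=> Kx; split; [case: (KVO _ Kx)|exact: subset_closure].
(* Without a boundary point in [V], the trace of [closure K] on [V] stays in [O]; it is connected,
   so maximality of the component puts it inside [K]. *)
move=> [Vx Kx]; have sub : V `&` closure K `<=` V `&` O.
  by move=> y [Vy Ky]; split=> //; apply: contrapT => Oy; apply: noz; exists K, y.
exists (V `&` closure K) => //; split => //.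
  by split => //; exact: subset_closure.
apply: (connected_between cK) => [y Ky|y []//].
by split; [case: (KVO _ Ky)|exact: subset_closure].
Qed.

(* The upper limit of the sets [C i] along [F]. *)
Definition limset I (F : set_system I) (C : I -> set T) : set T :=
  \bigcap_(S in F) closure (\bigcup_(i in S) C i).

Lemma limset_closed I (F : set_system I) C : closed (limset F C).
Proof. by apply: closed_bigI => S _; exact: closed_closure. Qed.

Lemma limset_sub_closed I (F : set_system I) C (E : set T) :
  closed E -> (\forall i \near F, C i `<=` E) -> limset F C `<=` E.
Proof.
move=> cE FE y /(_ _ FE) yE; rewrite (closure_id E).1//.
by apply: closureS yE => z [i /= CE /CE].
Qed.

Lemma limset_mem I (F : set_system I) {FF : ProperFilter F} C (a : I -> T) (x : T) :
  (\forall i \near F, C i (a i)) -> a @ F --> x -> limset F C x.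
Proof.
move=> Ca ax S FS B Bx.
have [i [Si [Cai Bai]]] := filter_ex (filterI FS (filterI Ca (ax _ Bx))).
by exists (a i); split=> //; exists i.
Qed.

Hypothesis cptT : compact [set: T].

(** Each point outside [V] has a neighborhood missed by [C i] for all [i] in some member of [F];
    compactness of the complement of [V] makes one member suffice. *)
Lemma limset_sub_open I (F : set_system I) {FF : Filter F} C (V : set T) :
  open V -> limset F C `<=` V -> \forall i \near F, C i `<=` V.
Proof.
move=> oV LV; have cptV : compact (~` V).
  by apply: subclosed_compact cptT _ => //; exact: open_closedC.
move/compact_near_coveringP : cptV => /(_ I F (fun i x => ~ C i x) FF) nc.
suff : \forall i \near F, ~` V `<=` (fun x => ~ C i x).
  by apply: filterS => i h x Cx; apply: contrapT => /h.
apply: nc => x Vx.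
have /existsNP[S /not_implyP[FS]] : ~ limset F C x by move=> /LV.
move=> /existsNP[B /not_implyP[Bx SB]].
exists (B, S) => //= -[y i] [/= By Si] Cy; apply: SB.
by exists y; split => //; exists i.
Qed.

Hypothesis hT : hausdorff_space T.

Lemma disjoint_closed_nbhs (A B : set T) :
  closed A -> closed B -> A `&` B = set0 ->
  exists U V, [/\ open U, open V, A `<=` U, B `<=` V & U `&` V = set0].
Proof.
move=> cA cB AB.
have : set_nbhs A (~` B).
  apply/set_nbhsP; exists (~` B); split => //; first exact: closed_openC.
  by apply/disjoints_subset.
move=> /(compact_normal hT cptT cA)[W /set_nbhsP[U [oU AU UW]] WB].
exists U, (~` closure W); split => //.
- exact/closed_openC/closed_closure.
- by move=> b Bb /WB.
- apply/disjoints_subset => u /UW Wu; rewrite setCK; exact: subset_closure.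
Qed.

(** Disjoint open neighborhoods of two closed pieces eventually cover [C i], so the connected [C i]
    lies in one of them. The convergent choice [a i] forces it to be the one around [x], and the
    limit misses the other. *)
Lemma limset_connected I (F : set_system I) {FF : ProperFilter F} C (a : I -> T) (x : T) :
  (\forall i \near F, connected (C i)) -> (\forall i \near F, C i (a i)) ->
  a @ F --> x -> connected (limset F C).
Proof.
move=> Cc Ca ax; have Lx : limset F C x := limset_mem Ca ax.
have cL := @limset_closed _ F C.
suff key A B : closed A -> closed B -> A `&` B = set0 ->
    limset F C = A `|` B -> A x -> B = set0.
  apply/connectedP => E [E0 LE [s1 s2]].
  have cE b : closed (E b).
    apply/closure_id/seteqP; split; first exact: subset_closure.
    move=> y Ey; have : limset F C y.
      rewrite ((closure_id (limset F C)).1 cL); apply: closureS Ey; rewrite LE.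
      by case: b => z Ez; [right|left].
    rewrite LE; case: b Ey => Ey [] // E'y; exfalso.
      by suff : (@set0 T) y by []; rewrite -s2.
    by suff : (@set0 T) y by []; rewrite -s1.
  have E01 : E false `&` E true = set0.
    by apply: separated_disjoint; split.
  have := Lx; rewrite LE => -[Ex|Ex].
    by have [y] := E0 true; rewrite (key _ _ (cE false) (cE true)).
  have [y] := E0 false; rewrite (key _ _ (cE true) (cE false)) 1?setIC//.
  by rewrite LE setUC.
move=> cA cB AB LAB Ax.
have [U [V [oU oV AU BV UV]]] := disjoint_closed_nbhs cA cB AB.
have nUV : \forall i \near F, C i `<=` U `|` V.
  apply: limset_sub_open; first exact: openU.
  by rewrite LAB => y [/AU|/BV]; [left|right].
have naU : \forall i \near F, U (a i).
  by apply: ax; apply: open_nbhs_nbhs; split=> //; exact: AU.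
have nU : \forall i \near F, C i `<=` ~` V.
  near=> i; have ci : connected (C i) by near: i.
  have Cai : C i (a i) by near: i.
  have Uai : U (a i) by near: i.
  have sUV : separated U V.
    split; rewrite 1?setIC; apply/disjoints_subset.
      move=> v Vv; move=> /(_ _ (open_nbhs_nbhs (conj oV Vv)))[w].
      by rewrite UV.
    move=> u Vu Uu; have [w] := Vu _ (open_nbhs_nbhs (conj oU Uu)).
    by rewrite setIC UV.
  have [|CU|CV] := connected_subset sUV _ ci; first by near: i.
    by move=> y /CU Uy Vy; have : set0 y by rewrite -UV.
  by exfalso; have : set0 (a i) by rewrite -UV; split => //; exact: CV.
rewrite -subset0 => b Bb.
have /(_ b) := limset_sub_closed (open_closedC oV) nU.
by apply; [rewrite LAB; right|exact: BV].
Unshelve. all: by end_near.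
Qed.

End continua.

(** * Iterates of small connected sets *)

(** Limits along an ultrafilter take the place of convergent subsequences; one ultrafilter serves
    several sequences simultaneously. *)
Lemma ultra_cvg (T : topologicalType) I (F : set_system I) (a : I -> T) :
  compact [set: T] -> UltraFilter F -> exists x : T, a @ F --> x.
Proof.
move=> cptT UF; have [x [_ xF]] := cptT (a @ F) _ filterT.
exists x => B Bx; have [//|nB] := in_ultra_setVsetC (a @^-1` B) UF.
by have [y [? ?]] := xF (~` B) B nB Bx.
Qed.

Lemma near_leqn (T : topologicalType) (P : nat -> T -> Prop) (x : T) n :
  (forall j, (j <= n)%N -> \forall y \near x, P j y) ->
  \forall y \near x, forall j, (j <= n)%N -> P j y.
Proof.
elim: n => [|n IH] H.
  by apply: filterS (H 0%N (leqnn _)) => y Py j; rewrite leqn0 => /eqP ->.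
have nIH : \forall y \near x, forall j, (j <= n)%N -> P j y.
  by apply: IH => j jn; apply: H; exact: leqW.
apply: filterS2 nIH (H n.+1 (leqnn _)) => y Pn Pn1 j.
by rewrite leq_eqVlt => /orP[/eqP -> //|]; exact: Pn.
Qed.

(** * Metric estimates on a compact space *)

Section compact_metric.
Variables (R : realType) (X : metricType R).
Implicit Types (A : set X) (h k : X -> X).

Lemma near_mdist (x : X) (e : R) : 0 < e -> \forall y \near x, mdist x y < e.
Proof.
move=> e0; apply/nbhs_ballP; exists e => // y; by rewrite ballEmdist.
Qed.

Lemma nbhs_mdist (x : X) (B : set X) : nbhs x B ->
  exists2 e : R, 0 < e & forall y, mdist x y < e -> B y.
Proof.
move=> /nbhs_ballP[e /= e0 eB]; exists e => // y xy; apply: eB.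
by rewrite ballEmdist.
Qed.

Lemma near_mdist_comp h (x : X) (e : R) : continuous h -> 0 < e ->
  \forall y \near x, mdist (h x) (h y) < e.
Proof. by move=> ch e0; exact: (ch x _ (near_mdist (h x) e0)). Qed.

Lemma open_mdist_lt h (z : X) (r : R) :
  continuous h -> open [set y | mdist z (h y) < r].
Proof.
move=> ch; rewrite openE => y /= zy.
have e0 : 0 < r - mdist z (h y) by lra.
apply: filterS (near_mdist_comp y ch e0) => w yw /=.
by have := metric_triangle z (h y) (h w); lra.
Qed.

Lemma closed_mdist_le h (z : X) (r : R) :
  continuous h -> closed [set y | mdist z (h y) <= r].
Proof.
move=> ch y yE /=; rewrite leNgt; apply/negP => rlt.
have [w [/= zw yw]] := yE _ (near_mdist_comp y ch (ltac:(lra) : 0 < mdist z (h y) - r)).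
by have := metric_triangle z (h w) (h y); rewrite [mdist (h w) _]metric_sym; lra.
Qed.

(** The bound is non-strict so that it passes to closures; stating it pairwise avoids suprema. *)
Definition iter_small h (n : nat) (r : R) A :=
  forall x y, A x -> A y -> mdist (iter n h x) (iter n h y) <= r.

Lemma iter_smallS h n r A B : A `<=` B -> iter_small h n r B -> iter_small h n r A.
Proof. by move=> AB sB x y /AB Bx /AB By; exact: sB. Qed.

Lemma iter_small_le h n r r' A : r <= r' -> iter_small h n r A -> iter_small h n r' A.
Proof. by move=> rr sA x y Ax Ay; exact: le_trans (sA _ _ Ax Ay) rr. Qed.

Lemma iter_small_image h n m r A :
  iter_small h n r (iter m h @` A) <-> iter_small h (n + m) r A.
Proof.
split=> sA x y.
  by move=> Ax Ay; rewrite !iterD; apply: sA; [exists x|exists y].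
by move=> [u Au <-] [v Av <-]; rewrite -!iterD; exact: sA.
Qed.

Lemma iter_small_center h n r (p : X) A :
  (forall x, A x -> mdist (iter n h p) (iter n h x) <= r) ->
  iter_small h n (r + r) A.
Proof.
move=> pA x y /pA px /pA py.
by have := metric_triangle (iter n h x) (iter n h p) (iter n h y);
  rewrite [mdist _ (iter n h p)]metric_sym; lra.
Qed.

Lemma continuous_iter h n : continuous h -> continuous (iter n h).
Proof.
move=> ch; elim: n => [|n IH] x; first exact: cvg_id.
by apply: (@continuous_comp _ _ _ (iter n h) h); [exact: IH|exact: ch].
Qed.

Arguments continuous_iter [h] n _.

Lemma iter_small_closure h n r A :
  continuous h -> iter_small h n r A -> iter_small h n r (closure A).
Proof.
move=> ch sA.
have half x y : A x -> closure A y -> mdist (iter n h x) (iter n h y) <= r.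
  move=> Ax Ay.
  have /closure_id cE := @closed_mdist_le (iter n h) (iter n h x) r (continuous_iter n ch).
  suff : closure [set y | mdist (iter n h x) (iter n h y) <= r] y by rewrite -cE.
  by apply: closureS Ay => z Az; exact: sA.
move=> x y Ax Ay.
have /closure_id cE := @closed_mdist_le (iter n h) (iter n h y) r (continuous_iter n ch).
rewrite metric_sym.
suff : closure [set x | mdist (iter n h y) (iter n h x) <= r] x by rewrite -cE.
by apply: closureS Ax => z Az; rewrite /= metric_sym; exact: half.
Qed.

Lemma connected_image h A : continuous h -> connected A -> connected (h @` A).
Proof.
by move=> ch cA; exact: connected_continuous_connected cA (continuous_subspaceT ch).
Qed.

Hypothesis cptX : compact [set: X].

Lemma mdist_bounded (x0 : X) : exists M : R, forall x y : X, mdist x y <= M.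
Proof.
suff [M HM] : exists M : R, forall x, mdist x0 x <= M.
  exists (M + M) => x y.
  by have := metric_triangle x x0 y; have := HM x; have := HM y;
    rewrite [mdist x x0]metric_sym; lra.
move/compact_near_coveringP : cptX.
move=> /(_ R +oo (fun M x => mdist x0 x <= M) _)[].
  move=> x _; exists (ball x 1, [set M | mdist x0 x + 1 <= M]) => /=.
    split; first exact: nbhsx_ballx.
    by apply: nbhs_pinfty_ge; exact: num_real.
  move=> [y M] /= []; rewrite ballEmdist /= => xy xM.
  by have := metric_triangle x0 x y; lra.
move=> M [_ HM]; exists (M + 1) => x; apply: (HM (M + 1)) => //; by rewrite ltrDl.
Qed.

Lemma le_diam A x y : A x -> A y -> mdist x y <= diam A.
Proof.
move=> Ax Ay; apply: ub_le_sup; last by exists (x, y).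
have [M HM] := mdist_bounded x; exists M => _ [[u v] _ <-]; exact: HM.
Qed.

Lemma diam_le A r : 0 <= r -> (forall x y, A x -> A y -> mdist x y <= r) -> diam A <= r.
Proof.
move=> r0 Ar; have [[x Ax]|A0] := pselect (A !=set0).
  apply: ge_sup; first by exists (mdist x x), (x, x).
  by move=> _ [[u v] [/= Au Av] <-]; exact: Ar.
(* For empty [A] the supremum takes its default value 0, which is where [0 <= r] enters. *)
rewrite /diam [X in sup X](_ : _ = set0) ?sup0// -subset0.
by move=> _ [[u v] [/= Au _] _]; apply: A0; exists u.
Qed.

Lemma unif_continuous_metric h (e : R) : continuous h -> 0 < e ->
  exists2 d : R, 0 < d & forall x y, mdist x y < d -> mdist (h x) (h y) < e.
Proof.
move=> ch e0; move/compact_near_coveringP : cptX.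
move=> /(_ R 0^'+ (fun d x => forall y, mdist x y < d -> mdist (h x) (h y) < e) _) nc.
have {nc} : \forall d \near (0 : R)^'+, [set: X] `<=`
    (fun x => forall y, mdist x y < d -> mdist (h x) (h y) < e).
  apply: nc => x _.
  have [r r0 xr] := nbhs_mdist (near_mdist_comp x ch (ltac:(lra) : 0 < e / 2)).
  exists (ball x (r / 2), [set d | d < r / 2]) => /=.
    split; first by apply: nbhsx_ballx; lra.
    by apply: nbhs_right_lt; lra.
  move=> [x' d] /= []; rewrite ballEmdist /= => xx' dr y x'y.
  have h1 := metric_triangle x x' y.
  have h2 := xr x' (ltac:(lra) : mdist x x' < r).
  have h3 := xr y (ltac:(lra) : mdist x y < r); have := metric_triangle (h x') (h x) (h y).
  by rewrite [mdist (h x') (h x)]metric_sym; lra.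
move=> [d /= d0 dP]; exists (d / 2); first lra.
move=> x y; apply: (dP (d / 2)) => //=; last lra.
by rewrite sub0r normrN gtr0_norm; lra.
Qed.

Lemma unif_continuous_iter h N (e : R) : continuous h -> 0 < e ->
  exists2 d : R, 0 < d & forall j, (j <= N)%N ->
    forall x y, mdist x y <= d -> mdist (iter j h x) (iter j h y) < e.
Proof.
move=> ch e0; elim: N => [|N [d d0 dN]].
  exists (e / 2); first lra.
  by move=> j; rewrite leqn0 => /eqP -> x y /=; lra.
have [d' d'0 dN1] := unif_continuous_metric (continuous_iter N.+1 ch) e0.
exists (Num.min d (d' / 2)); first by rewrite lt_min; apply/andP; split; lra.
move=> j; rewrite leq_eqVlt => /orP[/eqP ->|jN] x y; rewrite le_min => /andP[? ?].
  by apply: dN1; lra.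
exact: dN.
Qed.

End compact_metric.

Arguments closed_mdist_le {R X h} z r _.

Arguments continuous_iter {R X h} n _.

Section iterates.
Variables (T : Type) (f g : T -> T).
Hypotheses (fK : cancel f g) (gK : cancel g f).

Lemma iter_can n : cancel (iter n f) (iter n g).
Proof. by elim: n => // n IH x; rewrite iterSr iterS fK. Qed.

Lemma iter_can_le m n x : (m <= n)%N -> iter m g (iter n f x) = iter (n - m) f x.
Proof. by move=> mn; rewrite -{1}(subnKC mn) iterD iter_can. Qed.

(** This lets a forward window of length [N.*2] control a two-sided window about time [N]. *)
Lemma iterz_iter (n : int) N : (`|n| <= N)%N ->
  exists2 m, (m <= N.*2)%N & forall x, iterz f g n (iter N f x) = iter m f x.
Proof.
case: n => k /= kN.
  by exists (k + N)%N; [rewrite -addnn leq_add2r|move=> x; rewrite iterD].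
exists (N - k.+1)%N; first by rewrite -addnn; lia.
by move=> x; rewrite -iterS iter_can_le.
Qed.

End iterates.

(** * Uniform contraction from cw-expansiveness *)

Section cw_dynamics.
Variables (R : realType) (X : metricType R) (f g : X -> X).
Hypothesis cptX : compact [set: X].
Hypotheses (cf : continuous f) (cg : continuous g).
Hypothesis fK : cancel f g.
Variables (delta c : R).
Hypotheses (c0 : 0 < c) (cdelta : 2 * c < delta).
Hypothesis cwf : forall A : set X, A !=set0 -> connected A ->
  (forall n : int, diam (iterz f g n @` A) < delta) -> exists x, A = [set x].

Let hX : hausdorff_space X := @metric_hausdorff R X.

Lemma continuous_iterz n : continuous (iterz f g n).
Proof. by case: n => k; exact: continuous_iter. Qed.

(* Otherwise a limit of the continua [f^N A_N] would be a nondegenerate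
   continuum all of whose iterates are small. *)
Lemma window_contraction (eta : R) : 0 < eta -> exists N, forall A, connected A ->
  (forall j, (j <= N.*2)%N -> iter_small f j c A) -> iter_small f N eta A.
Proof.
move=> eta0; apply: contrapT => /forallNP noN.
have {noN} bad N : exists t : set X * (X * X), [/\ connected t.1, t.1 t.2.1, t.1 t.2.2,
    (forall j, (j <= N.*2)%N -> iter_small f j c t.1)
    & eta < mdist (iter N f t.2.1) (iter N f t.2.2)].
  move/existsNP : (noN N) => [A /not_implyP[cA /not_implyP[sA]]].
  move=> /existsNP[p /existsNP[q /not_implyP[Ap /not_implyP[Aq /negP]]]].
  by rewrite -ltNge => pq; exists (A, (p, q)).
have [t tP] := choice bad.
have [G [UG ooG]] := ultraFilterLemma (F := \oo) _.
have [x ax] := ultra_cvg (fun N => iter N f (t N).2.1) cptX UG.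
pose C N := iter N f @` (t N).1.
have Ca : \forall N \near G, C N (iter N f (t N).2.1).
  by apply: nearW => N; exists (t N).2.1 => //; case: (tP N).
have Cc : \forall N \near G, connected (C N).
  apply: nearW => N; case: (tP N) => cA _ _ _ _.
  by rewrite /C; apply: connected_image cA; exact: continuous_iter.
have PG : ProperFilter G by apply: ultra_proper.
have Lx : limset G C x by exact: limset_mem Ca ax.
have Lc : connected (limset G C) by exact: limset_connected cptX hX _ _ _ _ _ _ Cc Ca ax.
have [||z Lz] := cwf _ Lc; first by exists x.
  (* Points of the limit are compared with [x] only, whence the factor 2; [rho] uses part of the
     room left by [2 * c < delta] to replace [x] by its approximations. *)
  move=> n; have [rho [rho0 rhoP]] : exists rho : R, 0 < rho /\ 2 * (c + rho) < delta.
    by exists ((delta / 2 - c) / 2); move: cdelta; split; lra.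
  apply: (@le_lt_trans _ _ (2 * (c + rho))); last exact: rhoP.
  apply: diam_le => //; first by move: c0; lra.
  have xL y : limset G C y -> mdist (iterz f g n x) (iterz f g n y) <= c + rho.
    move: y; apply: (limset_sub_closed (closed_mdist_le _ _ (@continuous_iterz n))).
    have nx : \forall N \near G, mdist (iterz f g n x) (iterz f g n (iter N f (t N).2.1)) < rho.
      exact: ax _ (near_mdist_comp x (@continuous_iterz n) rho0).
    have nN : \forall N \near G, (`|n| <= N)%N by apply: ooG; exact: nbhs_infty_ge.
    apply: filterS2 nx nN => N nxN nN _ [u Au <-].
    case: (tP N) => _ Ap _ sA _.
    have [m mN mE] := iterz_iter fK nN.
    have := sA m mN _ _ Ap Au; rewrite -!mE => ?.
    have := metric_triangle (iterz f g n x) (iterz f g n (iter N f (t N).2.1))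
      (iterz f g n (iter N f u)); rewrite /=; lra.
  move=> _ _ [u Lu <-] [v Lv <-].
  have := xL _ Lu; have := xL _ Lv.
  have := metric_triangle (iterz f g n u) (iterz f g n x) (iterz f g n v).
  by rewrite [mdist _ (iterz f g n x)]metric_sym; lra.
have xz : x = z by move: Lx; rewrite Lz.
subst z.
(* The limit is the single point [x], so some [C N] lies in a ball too small for its two marked
   points, which are more than [eta] apart. *)
have : \forall N \near G, C N `<=` ball x (eta / 2).
  apply: (limset_sub_open cptX).
    by rewrite ballEmdist; apply: (@open_mdist_lt _ _ id) => u; exact: cvg_id.
  by rewrite Lz => _ ->; apply: ballxx; lra.
move=> /filter_ex[N CN]; case: (tP N) => _ Ap Aq _ pq.
have := CN _ (ex_intro2 _ _ _ Ap erefl); have := CN _ (ex_intro2 _ _ _ Aq erefl).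
rewrite ballEmdist /= => h1 h2.
have := metric_triangle (iter N f (t N).2.1) x (iter N f (t N).2.2).
by rewrite [mdist _ x]metric_sym; lra.
Qed.

End cw_dynamics.

Section window.
Variables (R : realType) (X : metricType R).
Implicit Types (A : set X) (f g : X -> X).

(** The form in which cw-expansiveness enters all later dynamical arguments. It speaks of forward
    iterates of one map, so it can be required of [f] and of its inverse separately. *)
Definition window_contracting f (c : R) := forall eta : R, 0 < eta ->
  exists N, forall A n, connected A -> (N <= n)%N ->
    (forall j, (j <= n + N)%N -> iter_small f j c A) -> iter_small f n eta A.

Definition ends_control f (e gam : R) := forall A n, connected A ->
  iter_small f 0 gam A -> iter_small f n gam A ->
  forall j, (j <= n)%N -> forall x y, A x -> A y -> mdist (iter j f x) (iter j f y) < e.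

Lemma cw_window_contracting f g (delta c : R) : compact [set: X] ->
  continuous f -> continuous g -> cancel f g -> 0 < c -> 2 * c < delta ->
  (forall A : set X, A !=set0 -> connected A ->
    (forall n : int, diam (iterz f g n @` A) < delta) -> exists x, A = [set x]) ->
  window_contracting f c.
Proof.
move=> cptX cf cg fK c0 cdelta cwf eta eta0.
have [N NP] := window_contraction cptX cf cg fK c0 cdelta cwf eta0.
(* Shifting by [n - N] turns the window from 0 to [N.*2] into the one from [n - N] to [n + N],
   centred at [n]. *)
exists N => A n cA Nn sA.
have := NP (iter (n - N) f @` A) (connected_image (continuous_iter _ cf) cA).
rewrite iter_small_image subnKC//; apply=> j jN.
by rewrite iter_small_image; apply: sA; lia.
Qed.

End window.

(** * Connected sets along orbit segments *)

Section window_dynamics.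
Variables (R : realType) (X : metricType R) (f g : X -> X) (c : R).
Hypotheses (cptX : compact [set: X]) (lcX : locally_connected X).
Hypotheses (cf : continuous f) (cg : continuous g).
Hypotheses (fK : cancel f g) (gK : cancel g f).
Hypothesis fwin : window_contracting f c.
Implicit Types A : set X.

Lemma small_forward_contracts A : connected A -> (forall j, iter_small f j c A) ->
  forall eta, 0 < eta -> exists N, forall n, (N <= n)%N -> iter_small f n eta A.
Proof.
move=> cA sA eta /fwin[N NP]; exists N => n Nn.
by apply: NP => // j _; exact: sA.
Qed.

(** The open Bowen ball of radius [e] around [p] for the times 0 to [n]. *)
Definition orbit_tube (n : nat) (p : X) (e : R) : set X :=
  [set w | forall j, (j <= n)%N -> mdist (iter j f p) (iter j f w) < e].

Lemma orbit_tube_open n p e : open (orbit_tube n p e).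
Proof.
rewrite openE => w pw; apply: near_leqn => j jn.
have o : open [set y | mdist (iter j f p) (iter j f y) < e].
  by apply: open_mdist_lt; exact: continuous_iter.
by apply: (open_nbhs_nbhs (conj o _)); exact: pw.
Qed.

Lemma orbit_tube_center n p e : 0 < e -> orbit_tube n p e p.
Proof. by move=> e0 j _; rewrite mdistxx. Qed.

(** The boundary argument needs an open connected set: take a component of the union of
    [gam / 2]-neighborhoods, measured at times 0 and [n]. Two such radii and [gam] add up to
    [2 * gam]. *)
Lemma connected_thickening A n p (gam : R) : connected A -> A p -> 0 < gam ->
  iter_small f 0 gam A -> iter_small f n gam A ->
  exists V, [/\ open V, connected V, A `<=` V, iter_small f 0 (2 * gam) V
             & iter_small f n (2 * gam) V].
Proof.
move=> cA Ap gam0 s0 sn.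
pose W := \bigcup_(a in A) ([set w | mdist a w < gam / 2] `&`
  [set w | mdist (iter n f a) (iter n f w) < gam / 2]).
have oW : open W.
  apply: bigcup_open => a _; apply: openI.
    by apply: (@open_mdist_lt _ _ id) => u; exact: cvg_id.
  exact: open_mdist_lt (continuous_iter n cf).
have AW : A `<=` W by move=> a Aa; exists a => //; rewrite /= !mdistxx; split; lra.
have sub := @connected_component_sub _ W p.
exists (connected_component W p); split.
- exact: component_open.
- exact: component_connected.
- exact: connected_component_max.
- move=> x y /sub[a Aa [/= ax _]] /sub[b Ab [/= bY _]].
  have /= := s0 _ _ Aa Ab; have := metric_triangle x a b; have := metric_triangle x b y.
  by rewrite [mdist x a]metric_sym; lra.
- move=> x y /sub[a Aa [/= _ ax]] /sub[b Ab [/= _ bY]].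
  have := sn _ _ Aa Ab; have := metric_triangle (iter n f x) (iter n f a) (iter n f b).
  have := metric_triangle (iter n f x) (iter n f b) (iter n f y).
  by rewrite [mdist _ (iter n f a)]metric_sym; lra.
Qed.

(** If a thickening of [A] left the Bowen ball of radius [e], a connected piece [K] would reach the
    boundary while staying [2 * e]-small. But window contraction gives [e / 2] at times far from
    both ends, and uniform continuity of iterates of [f] and [g] gives less than [e] near the
    ends. *)
Lemma ends_control_exists (e : R) : 0 < e -> 2 * e <= c ->
  exists2 gam, 0 < gam & ends_control f e gam.
Proof.
move=> e0 ec; have [N NP] := fwin (ltac:(lra) : 0 < e / 2).
have [d1 d10 d1P] := unif_continuous_iter cptX N cf e0.
have [d2 d20 d2P] := unif_continuous_iter cptX N cg e0.
(* Halved because the thickening doubles the bound at both ends. *)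
pose gam : R := Num.min d1 d2 / 2.
have gd1 : 2 * gam <= d1.
  by have : Num.min d1 d2 <= d1 by [rewrite ge_min lexx]; rewrite /gam; lra.
have gd2 : 2 * gam <= d2.
  by have : Num.min d1 d2 <= d2 by [rewrite ge_min lexx orbT]; rewrite /gam; lra.
have gam0 : 0 < gam.
  by have : 0 < Num.min d1 d2 by [rewrite lt_min d10]; rewrite /gam; lra.
exists gam => // A n cA s0 sn j jn p w Ap Aw.
have [V [oV cV AV s0V snV]] := connected_thickening cA Ap gam0 s0 sn.
apply: (_ : V `<=` orbit_tube n p e) => //; last exact: AV.
apply: contrapT => VO.
have [K [z [cK Kp KVO Kz [Vz Oz]]]] := component_reaches_boundary lcX oV cV
  (orbit_tube_open n p e) (AV _ Ap) (@orbit_tube_center n p e e0) VO.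
apply: Oz => i iN.
have sK m : (m <= n)%N -> iter_small f m c (closure K).
  move=> mn; apply: iter_small_closure => //.
  apply: (@iter_small_le _ _ f m (e + e)); first lra.
  by apply: (@iter_small_center _ _ f m e p) => x /KVO[_ /(_ m mn)/ltW].
have cKp : closure K p by exact: subset_closure.
have [iN'|Ni] := leqP i N.
  by apply: d1P => //; apply: le_trans gd1; exact: s0V (AV _ Ap) Vz.
have [niN|Nni] := leqP (n - i) N.
  have back u : iter i f u = iter (n - i) g (iter n f u).
    by rewrite (iter_can_le fK) ?leq_subr// subKn.
  rewrite !back; apply: d2P => //; apply: le_trans gd2.
  exact: snV (AV _ Ap) Vz.
have := NP (closure K) i (connected_closure cK) (ltnW Ni) _ p z cKp Kz.
have h m : (m <= i + N)%N -> iter_small f m c (closure K) by move=> ?; apply: sK; lia.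
by move=> /(_ h); lra.
Qed.

(** Points that follow the orbit of [p] up to time [n] and then land in [V] have small iterates
    forever. If [W] had other points, a connected piece through [p] would reach the boundary of the
    set [O] of such points; its closure contracts, so [ends_control] and window contraction at time
    [n] put the boundary point back in [O]. The size [gam] of [W] does not depend on [n]. *)
Lemma backward_stable (e gam : R) (V : set X) z : 0 < e -> 2 * e <= c -> 0 < gam ->
  ends_control f e gam -> open V -> V z -> (forall j, iter_small f j e V) ->
  exists N, forall n W, (N <= n)%N -> open W -> connected W -> W (iter n g z) ->
    iter_small f 0 gam W -> forall j, iter_small f j c W.
Proof.
move=> e0 ec gam0 ctl oV Vz sV.
have [rho rho0 rhoV] := nbhs_mdist (open_nbhs_nbhs (conj oV Vz)).
have [N NP] := fwin (ltac:(lra) : 0 < rho / 2).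
exists N => n W Nn oW cW Wz s0.
set p := iter n g z in Wz *.
have pz : iter n f p = z by rewrite /p (iter_can gK).
pose O := orbit_tube n p e `&` [set w | mdist z (iter n f w) < rho].
have oO : open O.
  by apply: openI; [exact: orbit_tube_open|exact: open_mdist_lt (continuous_iter n cf)].
have Op : O p by split; [exact: orbit_tube_center|rewrite /= pz mdistxx].
have sO B j : B `<=` O -> iter_small f j c B.
  move=> BO; have [jn|nj] := leqP j n.
    apply: (@iter_small_le _ _ f j (e + e)); first lra.
    by apply: (@iter_small_center _ _ f j e p) => x /BO[/(_ j jn)/ltW].
  apply: (@iter_small_le _ _ f j e); first lra.
  rewrite -(subnK (ltnW nj)) -iter_small_image.
  by apply: iter_smallS (sV _) => _ [x /BO[_ /= zx] <-]; exact: rhoV.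
apply: contrapT => /existsNP[j0 nsW].
have WO : ~ W `<=` O by move=> WO; apply: nsW; exact: sO.
have [K [v [cK Kp KWO Kv [Wv Ov]]]] := component_reaches_boundary lcX oW cW oO Wz Op WO.
have KO : K `<=` O by move=> x /KWO[].
have sK j : iter_small f j c (closure K).
  by apply: iter_small_closure => //; exact: sO.
have cKp : closure K p by exact: subset_closure.
have cK' := connected_closure cK.
have [M MP] := small_forward_contracts cK' sK gam0.
have s0K : iter_small f 0 gam (closure K).
  by apply: iter_small_closure => //; apply: iter_smallS s0 => x /KWO[].
apply: Ov; split.
  move=> j jn; apply: (ctl (closure K) (maxn M n)) => //.
    by apply: MP; exact: leq_maxl.
  by apply: leq_trans jn _; exact: leq_maxr.
have := NP (closure K) n cK' Nn (fun j _ => sK j) p v cKp Kv.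
by rewrite pz /=; lra.
Qed.

Lemma connected_nbhs_small (y : X) (gam : R) : 0 < gam ->
  exists W, [/\ open W, W y, connected W & iter_small f 0 gam W].
Proof.
move=> gam0.
have [W [oW Wy cW WB]] := lcX (near_mdist y (ltac:(lra) : 0 < gam / 2)).
exists W; split=> //; apply: (@iter_small_le _ _ f 0 (gam / 2 + gam / 2)); first lra.
by apply: (@iter_small_center _ _ f 0 _ y) => x /WB /= /ltW.
Qed.

(** * Nonexistence of stable open sets *)

Hypothesis conX : connected [set: X].
Hypothesis ntX : exists x y : X, x != y.

(* Two points of a stable open set recur simultaneously (as forward limits along
   a common sequence of times of their backward orbits), while being forward
   asymptotic; so they coincide. *)
Lemma no_stable_open_set (e : R) (O : set X) : 0 < e -> 2 * e <= c ->
  open O -> O !=set0 -> (forall j, iter_small f j e O) -> False.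
Proof.
move=> e0 ec oO [z Oz] sO.
have [gam gam0 ctl] := ends_control_exists e0 ec.
have [V [oV Vz cV VO]] := lcX (open_nbhs_nbhs (conj oO Oz)).
have sV j : iter_small f j e V by exact: iter_smallS (sO j).
(* If [V] is the single point [z], that point is open and closed, hence all of [X]. *)
suff V1 z' : V z' -> z' = z.
  have VE : V = [set z] by apply/seteqP; split=> [x /V1 //|x ->].
  have XE : [set z] = setT.
    apply: conX; first by exists z.
      by exists V => //; rewrite VE setTI.
    exists [set z]; last by rewrite setTI.
    exact/accessible_closed_set1/hausdorff_accessible/metric_hausdorff.
  case: ntX => x [y /eqP]; apply.
  have : [set z] x by rewrite XE.
  have : [set z] y by rewrite XE.
  by move=> /= -> ->.
move=> Vz'.
(* One ultrafilter for both points provides common return times to [W] and [W']. *)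
have [G [UG ooG]] := ultraFilterLemma (F := \oo) _.
have PG : ProperFilter G by apply: ultra_proper.
have recurrent u : V u -> exists W, [/\ connected W,
    (forall j, iter_small f j c W) & \forall n \near G, W (iter n g u)].
  move=> Vu; have [y uy] := ultra_cvg (fun n => iter n g u) cptX UG.
  have [W [oW Wy cW s0]] := connected_nbhs_small y gam0.
  have nW : \forall n \near G, W (iter n g u).
    by apply: uy; exact: open_nbhs_nbhs.
  have [N NP] := backward_stable e0 ec gam0 ctl oV Vu sV.
  exists W; split => //.
  have nN : \forall n \near G, (N <= n)%N by apply: ooG; exact: nbhs_infty_ge.
  have [n [Wn Nn]] := filter_ex (filterI nW nN).
  exact: NP Nn oW cW Wn s0.
have [W [cW sW nW]] := recurrent _ Vz.
have [W' [cW' sW' nW']] := recurrent _ Vz'.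
have sVc j : iter_small f j c V by apply: iter_small_le (sV j); lra.
have nge m : \forall n \near G, (m <= n)%N by apply: ooG; exact: nbhs_infty_ge.
apply/esym/mdist_positivity/eqP; rewrite eq_le mdist_ge0 andbT.
apply/ler_addgt0Pl => eta eta0; rewrite addr0.
have eta3 : 0 < eta / 3 by lra.
have [M MP] := small_forward_contracts cW sW eta3.
have [M' MP'] := small_forward_contracts cW' sW' eta3.
have [L LP] := small_forward_contracts cV sVc eta3.
have [n1 [Wn1 Wn1']] := filter_ex (filterI nW nW').
(* The backward orbit of [z] is in [W] at times [n1] and [n]; applying [f^n] shows that [z] is
   [eta / 3]-close to its image under [f^(n - n1)], and likewise for [z']. As [n - n1 >= L], the two
   images are [eta / 3]-close too. *)
have [n [[Wn Wn'] nN]] := filter_ex (filterI (filterI nW nW') (nge (M + M' + L + n1)%N)).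
have h1 := MP n (ltac:(lia)) _ _ Wn Wn1.
have h2 := MP' n (ltac:(lia)) _ _ Wn' Wn1'.
have h3 := LP (n - n1)%N (ltac:(lia)) _ _ Vz Vz'.
have n1n : (n1 <= n)%N by lia.
move: h1 h2; rewrite !(iter_can gK) => h1 h2.
have shift u : iter n f (iter n1 g u) = iter (n - n1) f u.
  by rewrite -{1}(subnK n1n) iterD (iter_can gK).
move: h1 h2; rewrite !shift => h1 h2.
have := metric_triangle z (iter (n - n1) f z) z'.
have := metric_triangle (iter (n - n1) f z) (iter (n - n1) f z') z'.
by rewrite [mdist _ z']metric_sym; move: h2; rewrite [mdist z' _]metric_sym; lra.
Qed.

End window_dynamics.

(** * Large stable continua *)

Section large_stable_continua.
Variables (R : realType) (X : metricType R) (f g : X -> X) (c : R).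
Hypotheses (cptX : compact [set: X]) (lcX : locally_connected X).
Hypotheses (conX : connected [set: X]) (ntX : exists x y : X, x != y).
Hypotheses (cf : continuous f) (cg : continuous g).
Hypotheses (fK : cancel f g) (gK : cancel g f).
Hypothesis gwin : window_contracting g c.

(** Since [g^k] does not keep [W] small, [W] leaves the Bowen ball of [g] around [p = f^m x], and a
    connected [K] reaches its boundary. The piece is the image of [closure K] under [g^m]. Were it
    within [gam / 2] of [x], both ends would be [gam]-small and [ends_control] would exclude the
    boundary point. *)
Lemma nonstable_piece (e gam : R) (W : set X) k m x : 0 < e -> e <= c ->
  0 < gam -> ends_control g (e / 2) gam -> open W -> connected W ->
  iter_small g 0 gam W -> ~ iter_small g k e W -> (k <= m)%N -> W (iter m f x) ->
  exists C, [/\ connected C, C x,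
    (forall j u, (j <= m)%N -> C u -> mdist (iter j f x) (iter j f u) <= e / 2)
    & exists2 u, C u & gam / 2 <= mdist x u].
Proof.
move=> e0 ec gam0 ctl oW cW s0 nsW km Wp.
set p := iter m f x in Wp.
have e20 : 0 < e / 2 by lra.
have WO : ~ W `<=` orbit_tube g m p (e / 2).
  move=> WO; apply: nsW.
  apply: (@iter_small_le _ _ g k (e / 2 + e / 2)); first lra.
  by apply: (@iter_small_center _ _ g k (e / 2) p) => w /WO/(_ k km)/ltW.
have [K [v [cK Kp KWO Kv [Wv Ov]]]] := component_reaches_boundary lcX oW cW
  (@orbit_tube_open _ _ g cg m p (e / 2)) Wp (@orbit_tube_center _ _ g m p _ e20) WO.
have gp : iter m g p = x by rewrite /p (iter_can fK).
have fg j w : (j <= m)%N -> iter j f (iter m g w) = iter (m - j) g w.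
  by move=> jm; rewrite (iter_can_le gK).
exists (iter m g @` closure K); split.
- exact: connected_image (continuous_iter m cg) (connected_closure cK).
- by exists p => //; exact: subset_closure.
- move=> j _ jm [w Kw <-]; rewrite -{1}gp !fg//.
  have /closure_id cE := closed_mdist_le (iter (m - j) g p) (e / 2) (continuous_iter (m - j) cg).
  suff : closure [set y | mdist (iter (m - j) g p) (iter (m - j) g y) <= e / 2] w by rewrite -cE.
  by apply: closureS Kw => y /KWO[_ /(_ (m - j)%N (leq_subr _ _))/ltW].
- apply: contrapT => nofar; apply: Ov => j jm.
  apply: (ctl (closure K) m) => //; last exact: subset_closure.
  + exact: connected_closure.
  + by apply: iter_small_closure => //; apply: iter_smallS s0 => y /KWO[].
  + apply: (@iter_small_le _ _ g m (gam / 2 + gam / 2)); first lra.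
    apply: (@iter_small_center _ _ g m (gam / 2) p) => y Ky.
    rewrite gp leNgt; apply/negP => far; apply: nofar.
    by exists (iter m g y); [exists y|exact: ltW].
Qed.

(* Pull back to [x] the pieces of a neighborhood of an omega-limit point of [x]
   that grow under backward iteration, and pass to the limit. *)
Lemma large_stable_continua (e : R) : 0 < e -> 2 * e <= c ->
  exists2 r, 0 < r & forall x, exists C, [/\ continuum C, C x,
    (forall j, iter_small f j e C) & exists2 u, C u & r <= mdist x u].
Proof.
move=> e0 ec.
have [gam gam0 ctl] := ends_control_exists cptX lcX cg cf gK gwin
  (ltac:(lra) : 0 < e / 2) (ltac:(lra) : 2 * (e / 2) <= c).
exists (gam / 2); first lra.
move=> x.
have [G [UG ooG]] := ultraFilterLemma (F := \oo) _.
have PG : ProperFilter G by apply: ultra_proper.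
have [y xy] := ultra_cvg (fun m => iter m f x) cptX UG.
have [W [oW Wy cW s0]] := connected_nbhs_small g lcX y gam0.
(* The absence of stable open sets is applied to the inverse; [k] depends on [W] only, not on
   [m]. *)
have [k nsW] : exists k, ~ iter_small g k e W.
  apply/existsNP => sW.
  apply: (no_stable_open_set cptX lcX cg cf gK fK gwin conX ntX e0 ec oW _ sW).
  by exists y.
have ec' : e <= c by lra.
(* The witness [set0] outside the relevant times makes the choice of [C] total. *)
have H m : exists C, (k <= m)%N -> W (iter m f x) -> [/\ connected C, C x,
    (forall j u, (j <= m)%N -> C u -> mdist (iter j f x) (iter j f u) <= e / 2)
    & exists2 u, C u & gam / 2 <= mdist x u].
  have [km|] := boolP (k <= m)%N; last by exists set0.
  have [Wm|] := pselect (W (iter m f x)); last by exists set0.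
  by have [C ?] := nonstable_piece e0 ec' gam0 ctl oW cW s0 nsW km Wm; exists C.
have [C CP] := choice H.
have nW : \forall m \near G, W (iter m f x) by apply: xy; exact: open_nbhs_nbhs.
have nge m0 : \forall m \near G, (m0 <= m)%N by apply: ooG; exact: nbhs_infty_ge.
have nC : \forall m \near G, [/\ connected (C m), C m x,
    (forall j u, (j <= m)%N -> C m u -> mdist (iter j f x) (iter j f u) <= e / 2)
    & exists2 u, C m u & gam / 2 <= mdist x u].
  by apply: filterS2 (nge k) nW => m km Wm; exact: CP.
have Cc : \forall m \near G, connected (C m) by apply: filterS nC => m [].
have Cx : \forall m \near G, C m x by apply: filterS nC => m [].
have ax : (fun _ : nat => x) @ G --> x by exact: cvg_cst.
have Lx : limset G C x by exact: limset_mem Cx ax.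
have Lc : connected (limset G C).
  exact: limset_connected cptX (@metric_hausdorff _ _) _ _ _ _ _ _ Cc Cx ax.
exists (limset G C); split => //.
- split => //; first by exists x.
  exact: subclosed_compact (@limset_closed _ _ G C) cptX _.
- move=> j; apply: (@iter_small_le _ _ f j (e / 2 + e / 2)); first lra.
  apply: (@iter_small_center _ _ f j (e / 2) x).
  apply: (limset_sub_closed (closed_mdist_le (iter j f x) (e / 2) (continuous_iter j cf))).
  by apply: filterS2 nC (nge j) => m [_ _ mC _] jm u /=; exact: mC.
(* The limit keeps a point at distance at least [gam / 2]: otherwise it lies in the open ball of
   that radius, and so do the nearby [C m]. *)
- apply: contrapT => nofar.
  have : \forall m \near G, C m `<=` [set u | mdist x u < gam / 2].
    apply: limset_sub_open => //.
      by apply: (@open_mdist_lt _ _ id) => u; exact: cvg_id.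
    by move=> u Lu /=; rewrite ltNge; apply/negP => ?; apply: nofar; exists u.
  move=> nlt; have [m [[_ _ _ [u Cu ur]] mlt]] := filter_ex (filterI nC nlt).
  by have := mlt u Cu; rewrite /= ltNge ur.
Qed.

End large_stable_continua.

(** * The atlas of a class of continua *)

Section class_atlas.
Variables (T : topologicalType) (K : set (set T)).
Hypotheses (cptT : compact [set: T]) (hT : hausdorff_space T).
Hypothesis K_continuum : K `<=` @continuum T.
Hypothesis K_sub : forall C D, K C -> continuum D -> D `<=` C -> K D.
Hypothesis K_setU : forall C D, K C -> K D -> C `&` D !=set0 -> K (C `|` D).
Hypothesis K_set1 : forall x, K [set x].
Implicit Types (Y Z U V C : set T).

Local Notation plaque := (class_plaque K).

Lemma class_plaque_refl Y x : Y x -> plaque Y x x.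
Proof. by move=> Yx; exists [set x]; split=> // _ ->. Qed.

Lemma class_plaque_sub Y x : plaque Y x `<=` Y.
Proof. by move=> y [C [_ CY _ Cy]]; exact: CY. Qed.

Lemma class_plaqueS Y Z x : Z `<=` Y -> plaque Z x `<=` plaque Y x.
Proof. by move=> ZY y [C [KC CZ Cx Cy]]; exists C; split=> // z /CZ/ZY. Qed.

Lemma class_plaque_sym Y x y : plaque Y x y -> plaque Y y x.
Proof. by move=> [C [*]]; exists C. Qed.

Lemma class_plaque_trans Y y x z : plaque Y x y -> plaque Y y z -> plaque Y x z.
Proof.
move=> [C [KC CY Cx Cy]] [D [KD DY Dy Dz]]; exists (C `|` D); split.
- by apply: K_setU => //; exists y.
- by move=> u [/CY|/DY].
- by left.
- by right.
Qed.

Lemma class_plaque_eq Y x y : plaque Y x y -> plaque Y x = plaque Y y.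
Proof.
move=> xy; apply/seteqP; split=> z; apply: class_plaque_trans => //.
exact: class_plaque_sym.
Qed.

(** The component is a continuum inside a member of [K], hence in [K]. Restrictions to an
    intersection of closures thus depend on the intersection only, which gives compatibility of the
    atlas. *)
Lemma class_plaque_component Y Z x : closed Z -> Z `<=` Y -> Z x ->
  K (plaque Y x) -> monotone_restriction (plaque Y) Z x = plaque Z x.
Proof.
move=> cZ ZY Zx KY; apply/seteqP; split=> [y Dy|y [C [KC CZ Cx Cy]]]; last first.
  have [_ _ cC] := K_continuum KC.
  by exists C => //; split=> // z Cz; split; [exists C; split=> // u /CZ/ZY|exact: CZ].
have [_ cptP _] := K_continuum KY.
have cD : closed (connected_component (plaque Y x `&` Z) x).
  by apply: component_closed; apply: closedI => //; exact: compact_closed.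
have sub := @connected_component_sub _ (plaque Y x `&` Z) x.
have Dx : connected_component (plaque Y x `&` Z) x x.
  by apply: connected_component_refl; split=> //; apply: class_plaque_refl; exact: ZY.
exists (connected_component (plaque Y x `&` Z) x); split=> //; last by move=> z /sub[].
apply: (K_sub KY); last by move=> z /sub[].
split; [by exists x|exact: subclosed_compact cptT _|exact: component_connected].
Qed.


Lemma limset_plaque_continuum Y (P : T -> set T) x : closed Y -> Y x ->
  (forall y, Y y -> [/\ connected (P y), P y y & P y `<=` Y]) ->
  [/\ continuum (limset (within Y (nbhs x)) P), limset (within Y (nbhs x)) P x
    & limset (within Y (nbhs x)) P `<=` Y].
Proof.
move=> cY Yx YP.
have PF : ProperFilter (within Y (nbhs x)).
  by apply: within_nbhs_proper; exact: subset_closure.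
have Pc : \forall y \near within Y (nbhs x), connected (P y).
  by rewrite near_withinE; apply: nearW => y Yy; case: (YP y Yy).
have Py : \forall y \near within Y (nbhs x), P y y.
  by rewrite near_withinE; apply: nearW => y Yy; case: (YP y Yy).
have PY : \forall y \near within Y (nbhs x), P y `<=` Y.
  by rewrite near_withinE; apply: nearW => y Yy; case: (YP y Yy).
have idx : id @ within Y (nbhs x) --> x by exact: cvg_within.
have Lx : limset (within Y (nbhs x)) P x by exact: limset_mem Py idx.
split=> //; last exact: limset_sub_closed.
split; first by exists x.
  exact: subclosed_compact (@limset_closed _ _ _ _) cptT _.
exact: limset_connected cptT hT _ _ _ _ _ _ Pc Py idx.
Qed.

(** Upper semicontinuity follows by compactness once upper limits of nearby plaques stay in the
    plaque of the limit point. *)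
Lemma class_decomposition Y : closed Y -> (forall x, Y x -> K (plaque Y x)) ->
  (forall x, Y x -> limset (within Y (nbhs x)) (plaque Y) `<=` plaque Y x) ->
  decomposition Y (plaque Y).
Proof.
move=> cY KY limY; split.
- by move=> x Yx; split; [exact/K_continuum/KY|exact: class_plaque_sub].
- by move=> x; exact: class_plaque_refl.
- move=> x y Yx Yy; have [[z [xz yz]]|xy0] := pselect (plaque Y x `&` plaque Y y !=set0).
    by left; rewrite (class_plaque_eq xz) (class_plaque_eq yz).
  by right; apply/eqP/negPn/negP => /set0P.
- move=> x V Yx oV xV.
  suff : \forall y \near within Y (nbhs x), plaque Y y `<=` V by rewrite near_withinE.
  exact: limset_sub_open cptT _ _ _ _ _ oV (subset_trans (limY x Yx) xV).
Qed.

Lemma class_plaque_connected Y x : Y x -> K (plaque Y x) ->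
  [/\ connected (plaque Y x), plaque Y x x & plaque Y x `<=` Y].
Proof.
move=> Yx KY; have [_ _ ?] := K_continuum KY.
by split=> //; [exact: class_plaque_refl|exact: class_plaque_sub].
Qed.

(** Plaques of [Z] are components of traces of plaques of [Y]. Upper semicontinuity on [Y] keeps a
    limit of plaques of [Z] inside a plaque of [Y], so the limit is in [K] by heredity and belongs
    to a plaque of [Z]. *)
Lemma class_plaque_restrict Y Z : closed Z -> Z `<=` Y ->
  decomposition Y (plaque Y) -> (forall x, Y x -> K (plaque Y x)) ->
  decomposition Z (plaque Z) /\ forall x, Z x -> K (plaque Z x).
Proof.
move=> cZ ZY [dY _ _ uscY] KY.
have KZ x : Z x -> K (plaque Z x).
  move=> Zx; have Yx := ZY _ Zx; apply: (K_sub (KY x Yx)); last exact: class_plaqueS.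
  rewrite -(class_plaque_component cZ ZY Zx (KY x Yx)).
  have [_ cptP _] := K_continuum (KY x Yx).
  split.
  - by exists x; apply: connected_component_refl; split=> //; exact: class_plaque_refl.
  - apply: subclosed_compact cptT _ => //; apply: component_closed; apply: closedI => //.
    exact: compact_closed.
  - exact: component_connected.
split=> //; apply: class_decomposition => // x Zx.
have [ctL Lx LZ] := limset_plaque_continuum cZ Zx (fun y Zy => class_plaque_connected Zy (KZ y Zy)).
set L := limset _ _ in ctL Lx LZ *.
have Yx := ZY _ Zx; have [[_ cptP _] _] := dY x Yx.
have LY : L `<=` plaque Y x.
  move=> z Lz; apply: contrapT => nz.
  have cz : closed [set z] by apply: accessible_closed_set1; exact: hausdorff_accessible.
  have [|U [V [oU oV PU zV UV]]] := disjoint_closed_nbhs cptT hT (compact_closed hT cptP) cz.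
    by rewrite -subset0 => u [Pu uz]; apply: nz; rewrite -uz.
  have : L `<=` ~` V.
    apply: limset_sub_closed; first exact: open_closedC.
    have : \forall y \near x, Y y -> plaque Y y `<=` U by exact: uscY.
    apply: filterS => y yU Zy u Zu Vu.
    have : (U `&` V) u by split=> //; apply: yU (ZY _ Zy) _ _; exact: class_plaqueS Zu.
    by rewrite UV.
  by move=> /(_ z Lz); apply; exact: zV.
move=> z Lz; exists L; split => //; exact: (K_sub (KY x Yx) ctL LY).
Qed.

Lemma class_domain_sub U V : class_domain K V -> open U -> U `<=` V -> class_domain K U.
Proof.
move=> [oV dV KV] oU UV.
by have [] := class_plaque_restrict (@closed_closure _ U) (closureS UV) dV KV.
Qed.

Lemma class_domain_basis :
  (forall x, exists2 U, class_domain K U & U x) -> complete_basis (class_domain K).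
Proof.
move=> cov; split; last by move=> V U dV oU; exact: class_domain_sub.
split; first by move=> U [].
move=> x B; rewrite nbhsE => -[B' [oB' B'x] B'B].
have [U dU Ux] := cov x; have [oU _ _] := dU.
exists (U `&` B'); last by move=> y [_ /B'B].
split; last by split.
by apply: class_domain_sub dU (openI oU oB') _ => y [].
Qed.

Lemma class_atlas :
  (forall x, exists2 U, class_domain K U & U x) -> atlas (class_domain K) plaque.
Proof.
move=> cov; split.
- by move=> U [].
- by apply/seteqP; split=> // x _; have [U dU Ux] := cov x; exists U.
- by move=> U [].
move=> U V [_ _ KU] [_ _ KV] x Ux Vx.
have cI : closed (closure U `&` closure V) by apply: closedI; exact: closed_closure.
rewrite !class_plaque_component //; [exact: KV|exact: KU].
Qed.

Lemma open_plaque_class_sub P x : open_plaque (class_domain K) plaque P ->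
  P x -> exists C, [/\ K C, C x & P `<=` C].
Proof.
move=> [U [z [[_ _ KU] Uz ->]]] Px.
have sub := @connected_component_sub _ (plaque (closure U) z `&` U) z.
exists (plaque (closure U) z); split; last by move=> y /sub[].
  exact/KU/subset_closure.
by have [] := sub _ Px.
Qed.

Lemma class_sub_open_plaque U C x : K C -> C `<=` U -> C x ->
  C `<=` monotone_restriction (plaque (closure U)) U x.
Proof.
move=> KC CU Cx; have [_ _ cC] := K_continuum KC.
apply: connected_component_max => // y Cy; split; last exact: CU.
by exists C; split=> // z /CU; exact: subset_closure.
Qed.

Hypothesis absorb : forall C x, K C -> C x -> exists2 U, class_domain K U & C `<=` U.

Lemma class_domain_cover x : exists2 U, class_domain K U & U x.
Proof. by have [U dU sub] := absorb (K_set1 x) erefl; exists U => //; exact: sub. Qed.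

(** A chain of plaques lies in a chain of meeting members of [K], whose union is again in [K];
    conversely [absorb] puts a member of [K] in a single plaque, so chains of one plaque suffice. *)
Lemma class_leaf x : leaf (class_domain K) plaque x = plaque setT x.
Proof.
apply/seteqP; split=> y.
  move=> [n [P [oP P0 Pn PP]]].
  suff H i : (i <= n)%N -> P i `<=` plaque setT x by exact: H Pn.
  elim: i => [_|i IH lin] z Pz.
    have [C [KC Cx PC]] := open_plaque_class_sub (oP 0%N (leq0n _)) P0.
    by exists C; split=> //; exact: PC.
  have [w [Pw Pw']] := PP i lin.
  apply: class_plaque_trans (IH (ltnW lin) w Pw) _.
  have [C [KC Cw PC]] := open_plaque_class_sub (oP i.+1 lin) Pw'.
  by exists C; split=> //; exact: PC.
move=> [C [KC _ Cx Cy]]; have [U dU CU] := absorb KC Cx.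
have sub := class_sub_open_plaque KC CU Cx.
exists 0%N, (fun _ => monotone_restriction (plaque (closure U)) U x); split=> //.
- by move=> i _; exists U, x; split=> //; exact: CU.
- exact: sub.
- exact: sub.
Qed.

Lemma decomposition_ext Y (Q Q' : T -> set T) : (forall x, Y x -> Q x = Q' x) ->
  decomposition Y Q -> decomposition Y Q'.
Proof.
move=> QQ [d1 d2 d3 d4]; split.
- by move=> x Yx; rewrite -QQ//; exact: d1.
- by move=> x Yx; rewrite -QQ//; exact: d2.
- by move=> x y Yx Yy; rewrite -!QQ//; exact: d3.
- move=> x V Yx oV; rewrite -QQ// => xV.
  by apply: filterS (d4 x V Yx oV xV) => y yV Yy; rewrite -QQ//; exact: yV.
Qed.

(* A K-continuum in the closure of a domain of a larger atlas lies in some domain of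
   the class atlas, where compatibility forces it into a single plaque. *)
Lemma class_maximal_atlas : maximal_atlas K (class_domain K) plaque.
Proof.
split.
- exact/class_atlas/class_domain_cover.
- by move=> U x [_ _]; exact.
move=> UU' Q' [opU' _ dec' comp'] KQ' [domU' eqQ'].
apply/seteqP; split; last exact: domU'.
move=> U UU'U.
have dU := dec' U UU'U.
have QE x : closure U x -> Q' (closure U) x = plaque (closure U) x.
  move=> Ux; have [d1 d2 _ _] := dU.
  apply/seteqP; split=> y.
    move=> Qy; exists (Q' (closure U) x); split=> //; last exact: d2.
      exact: KQ'.
    by have [] := d1 x Ux.
  move=> [C [KC CU Cx Cy]]; have [V dV CV] := absorb KC Cx.
  have [_ _ cC] := K_continuum KC.
  have CV' : C `<=` closure V by move=> z /CV; exact: subset_closure.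
  have /connected_component_sub[] // :
      monotone_restriction (Q' (closure U)) (closure U `&` closure V) x y.
  rewrite (comp' U V UU'U (domU' _ dV) x Ux (CV' _ Cx)) /monotone_restriction.
  rewrite eqQ'//; last exact: CV'.
  exists C => //; split=> // z Cz; split; last by split; [exact: CU|exact: CV'].
  by exists C.
split; first exact: opU'.
  exact: decomposition_ext QE dU.
by move=> x Ux; rewrite -QE//; exact: KQ'.
Qed.

End class_atlas.

(** * Transport of class atlases by a homeomorphism *)

Section transport.
Variables (T : topologicalType) (K : set (set T)) (h k : T -> T).
Hypotheses (ch : continuous h) (ck : continuous k) (hK : cancel h k) (kK : cancel k h).
Hypotheses (Kh : forall C, K C -> K (h @` C)) (Kk : forall C, K C -> K (k @` C)).

Lemma image_can (A : set T) : h @` A = k @^-1` A.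
Proof.
apply/seteqP; split=> [_ [x Ax <-]|y Ay]; first by rewrite /= hK.
by exists (k y).
Qed.

Lemma open_homeo (U : set T) : open U -> open (h @` U).
Proof. by rewrite image_can => oU; apply: open_comp oU => x _; exact: ck. Qed.

Lemma closure_homeo (U : set T) : closure (h @` U) = h @` closure U.
Proof.
apply/seteqP; split.
  have cl : closed (h @` closure U).
    by rewrite image_can; apply: closed_comp (@closed_closure _ U) => x _; exact: ck.
  rewrite [X in _ `<=` X](closure_id _).1//; apply: closureS.
  by move=> _ [x Ux <-]; exists x => //; exact: subset_closure.
move=> _ [x Ux <-] B hB; have [y [Uy By]] := Ux _ (ch hB).
by exists (h y); split=> //; exists y.
Qed.

Lemma class_plaque_homeo Y x : class_plaque K (h @` Y) (h x) = h @` class_plaque K Y x.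
Proof.
apply/seteqP; split=> y.
  move=> [C [KC CY Cx Cy]]; exists (k y); last exact: kK.
  exists (k @` C); split.
  - exact: Kk.
  - by move=> _ [z /CY[w Yw <-] <-]; rewrite hK.
  - by exists (h x).
  - by exists y.
move=> [z [C [KC CY Cx Cz]] <-]; exists (h @` C); split.
- exact: Kh.
- by move=> _ [w Cw <-]; exists w => //; exact: CY.
- by exists x.
- by exists z.
Qed.

Lemma class_domain_homeo U : class_domain K U -> class_domain K (h @` U).
Proof.
move=> [oU [d1 d2 d3 d4] KU]; split; first exact: open_homeo.
  rewrite closure_homeo; split.
  - move=> _ [x Ux <-]; rewrite class_plaque_homeo.
    have [[C0 C1 C2] sub] := d1 x Ux; split; last first.
      by move=> _ [y /sub Uy <-]; exists y.
    split; first by case: C0 => y ?; exists (h y), y.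
      exact: continuous_compact (continuous_subspaceT ch) C1.
    exact: connected_continuous_connected C2 (continuous_subspaceT ch).
  - by move=> _ [x Ux <-]; rewrite class_plaque_homeo; exists x => //; exact: d2.
  - move=> _ _ [x Ux <-] [y Uy <-]; rewrite !class_plaque_homeo.
    have [->|xy] := d3 x y Ux Uy; [by left|right].
    rewrite -subset0 => _ [[u xu <-] [v yv]] /(congr1 k); rewrite !hK => vu.
    by suff : (@set0 T) u by []; rewrite -xy; split=> //; rewrite -vu.
  - move=> _ V [x Ux <-] oV; rewrite class_plaque_homeo => xV.
    have oV' : open (h @^-1` V) by apply: open_comp oV => y _; exact: ch.
    have nx : \forall y \near x, closure U y -> class_plaque K (closure U) y `<=` h @^-1` V.
      by apply: d4 => // y xy; apply: xV; exists y.
    have : \forall y \near h x, closure U (k y) -> class_plaque K (closure U) (k y) `<=` h @^-1` V.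
      have : k y @[y --> h x] --> k (h x) by exact: ck.
      by rewrite hK => /(_ _ nx).
    apply: filterS => y yV [z Uz zy]; rewrite -zy class_plaque_homeo.
    move: yV; rewrite -zy hK => /(_ Uz) yV _ [w zw <-]; exact: yV.
move=> y; rewrite closure_homeo => -[x Ux <-]; rewrite class_plaque_homeo.
exact/Kh/KU.
Qed.

End transport.

Lemma plaque_compact_cover (T : topologicalType) UU (Q : set T -> T -> set T)
    (L : set T) (P : nat -> set T) :
  atlas UU Q -> complete_basis UU -> plaque_compact UU Q L ->
  (forall n, open_plaque UU Q (P n)) -> L `<=` \bigcup_n P n ->
  exists N, L `<=` \bigcup_(n in [set n | (n <= N)%N]) P n.
Proof.
move=> at_ cb cptL oP LP.
have oP' n : open (P n : set (plaque_space UU Q)).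
  by apply: (open_plaque_spaceP _ at_ cb).2 => x Px; exists (P n); split.
move/compact_near_coveringP : cptL.
move=> /(_ nat \oo (fun N x => exists2 n, (n <= N)%N & P n x) _)[].
  move=> x /LP[n _ Px].
  exists (P n : set (plaque_space UU Q), [set N | (n <= N)%N]) => /=.
    by split; [apply: open_nbhs_nbhs; split|exact: nbhs_infty_ge].
  by move=> [y N] /= [Py nN]; exists n.
move=> N _ NP; exists N => x Lx; have [n nN Px] := NP N (leqnn N) x Lx.
by exists n.
Qed.

(** * Stable continua *)

Section iterzN.
Variables (T : Type) (f g : T -> T).

Lemma iterzN (n : int) : iterz g f n = iterz f g (- n).
Proof. by case: n => [[|n]|n]; apply/funext. Qed.

End iterzN.

Section stable_class.
Variables (R : realType) (X : metricType R) (f g : X -> X).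
Hypothesis cptX : compact [set: X].
Hypotheses (fK : cancel f g) (gK : cancel g f).
Hypotheses (cf : continuous f) (cg : continuous g).

(** Lets the unstable half of the theorem be read off from the stable half for the inverse. *)
Lemma unstableE : unstable f g = stable g f.
Proof.
have E C : (fun n : nat => diam (iterz f g (- n%:Z) @` C)) =
    (fun n : nat => diam (iterz g f n%:Z @` C)).
  by apply/funext => n; rewrite -iterzN.
by apply/seteqP; split=> C [ctC H]; split=> //; move: H; rewrite E.
Qed.

Lemma cw_expansive_sym : cw_expansive f g -> cw_expansive g f.
Proof.
move=> [delta d0 H]; exists delta => // A A0 cA sA; apply: H => // n.
by have := sA (- n); rewrite iterzN opprK.
Qed.

Lemma stableP C : stable f g C <-> continuum C /\
  forall eta, 0 < eta -> exists N, forall n, (N <= n)%N -> iter_small f n eta C.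
Proof.
split=> -[ctC H]; split=> //.
  move=> eta eta0; move/cvgrPdist_le : H => /(_ eta eta0)[N _ NP].
  exists N => n Nn x y Cx Cy.
  have := NP n Nn; rewrite /= sub0r normrN => /(le_trans (ler_norm _)).
  by apply: le_trans; exact: le_diam.
apply/cvgrPdist_le => eta eta0; have [N NP] := H eta eta0.
exists N => // n Nn; rewrite /= sub0r normrN ger0_norm.
  apply: diam_le; first exact: ltW.
  by move=> _ _ [x Cx <-] [y Cy <-]; exact: NP.
case: ctC => -[x Cx] _ _.
apply: le_trans (mdist_ge0 (iter n f x) (iter n f x)) _.
by apply: le_diam => //; exists x.
Qed.

Lemma stable_continuum : stable f g `<=` @continuum X.
Proof. by move=> C []. Qed.

Lemma stable_sub C D : stable f g C -> continuum D -> D `<=` C -> stable f g D.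
Proof.
move=> /stableP[_ H] ctD DC; apply/stableP; split=> // eta /H[N NP].
by exists N => n /NP; exact: iter_smallS.
Qed.

Lemma stable_setU C D : stable f g C -> stable f g D -> C `&` D !=set0 ->
  stable f g (C `|` D).
Proof.
move=> /stableP[[[x Cx] cC connC] HC] /stableP[[_ cD connD] HD] CD.
apply/stableP; split.
  by split; [exists x; left|exact: compactU|exact: connectedU].
move: CD => [z [Cz Dz]] eta eta0; have eta2 : 0 < eta / 2 by lra.
have [N NP] := HC _ eta2; have [M MP] := HD _ eta2; exists (N + M)%N => n NMn.
have sC := NP n (ltac:(lia)); have sD := MP n (ltac:(lia)).
apply: (@iter_small_le _ _ f n (eta / 2 + eta / 2)); first lra.
by apply: (@iter_small_center _ _ f n (eta / 2) z) => y [Cy|Dy]; [exact: sC|exact: sD].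
Qed.

Lemma stable_set1 x : stable f g [set x].
Proof.
apply/stableP; split.
  by split; [exists x|exact: compact_set1|exact: connected1].
by move=> eta eta0; exists 0%N => n _ y z -> ->; rewrite mdistxx ltW.
Qed.

Lemma continuum_image (h : X -> X) (C : set X) : continuous h -> continuum C -> continuum (h @` C).
Proof.
move=> ch [[x Cx] cC connC]; split; first by exists (h x), x.
  exact: continuous_compact (continuous_subspaceT ch) cC.
exact: connected_image ch connC.
Qed.

Lemma stable_iter m C : stable f g C -> stable f g (iter m f @` C).
Proof.
move=> /stableP[ctC H]; apply/stableP; split.
  exact: continuum_image (continuous_iter m cf) ctC.
move=> eta /H[N NP]; exists N => n Nn; apply/iter_small_image; apply: NP; lia.
Qed.

Lemma stable_iter_inv m C : stable f g C -> stable f g (iter m g @` C).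
Proof.
move=> /stableP[ctC H]; apply/stableP; split.
  exact: continuum_image (continuous_iter m cg) ctC.
move=> eta /H[N NP]; exists (N + m)%N => n Nn _ _ [x Cx <-] [y Cy <-].
have mn : (m <= n)%N by lia.
rewrite -(subnK mn) !iterD !(iter_can gK); apply: NP => //; lia.
Qed.

Lemma stable_iterz_homeo (n : int) : exists k : X -> X,
  [/\ continuous k, cancel (iterz f g n) k, cancel k (iterz f g n),
    (forall C, stable f g C -> stable f g (iterz f g n @` C)) &
    forall C, stable f g C -> stable f g (k @` C)].
Proof.
case: n => n; [exists (iter n g)|exists (iter n.+1 f)]; split.
- exact: continuous_iter.
- exact: iter_can.
- exact: iter_can.
- exact: stable_iter.
- exact: stable_iter_inv.
- exact: continuous_iter.
- exact: iter_can.
- exact: iter_can.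
- exact: stable_iter_inv.
- exact: stable_iter.
Qed.

Lemma stable_invariant : invariant_atlas f g (stable_domain f g) (stable_plaque f g).
Proof.
move=> n U dU; have [k [ck hK kK Kh Kk]] := stable_iterz_homeo n.
have ch : continuous (iterz f g n) by exact: continuous_iterz.
split; first exact: (class_domain_homeo ch ck hK kK Kh Kk dU).
by move=> x _; exact: (class_plaque_homeo hK kK Kh Kk).
Qed.

(** * Stable charts *)

Variables (e c gam : R).
Hypotheses (e0 : 0 < e) (ec : 4 * e <= c) (gam0 : 0 < gam).
Hypotheses (fwin : window_contracting f c) (ctl : ends_control f e gam).

Lemma small_forward_stable C : continuum C -> (forall j, iter_small f j c C) ->
  stable f g C.
Proof.
move=> ctC sC; apply/stableP; split=> // eta eta0.
by case: ctC => _ _ connC; exact: small_forward_contracts fwin _ connC sC _ eta0.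
Qed.

(** A stable continuum is also small at all late times, so [ends_control] bounds every time in
    between, uniformly over all such continua. *)
Lemma stable_iter_small C : stable f g C -> iter_small f 0 gam C ->
  forall j, iter_small f j e C.
Proof.
move=> /stableP[[_ _ cC] H] s0 j x y Cx Cy; have [N NP] := H _ gam0.
apply/ltW/(ctl cC s0 (NP (N + j)%N (leq_addr _ _)) (leq_addl _ _) Cx Cy).
Qed.

(** Any two points of a plaque of [closure U] share a stable continuum of size at most [gam], so the
    plaque is [e]-small at all times. Its closure and the limits of plaques are then [c]-small,
    hence stable, and are absorbed by the plaque. *)
Lemma small_stable_domain U : open U -> iter_small f 0 gam U -> stable_domain f g U.
Proof.
move=> oU s0U; pose Y := closure U.
have hX : hausdorff_space X := @metric_hausdorff R X.
have cY : closed Y by exact: closed_closure.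
have s0 : iter_small f 0 gam Y.
  exact: iter_small_closure cf s0U.
pose P := stable_plaque f g Y.
have sP j x : iter_small f j e (P x).
  move=> y z xy xz.
  have [C [KC CY Cy Cz]] := class_plaque_trans stable_setU (class_plaque_sym xy) xz.
  exact: stable_iter_small KC (iter_smallS CY s0) j y z Cy Cz.
have KP x : Y x -> stable f g (P x).
  move=> Yx; have Px : P x x := class_plaque_refl stable_set1 Yx.
  have cP : connected (P x).
    suff E : connected_component (P x) x = P x by rewrite -E; exact: component_connected.
    apply/seteqP; split; first exact: connected_component_sub.
    move=> y [C [KC CY Cx Cy]]; exists C => //; split=> //; last by case: KC => -[].
    by move=> z Cz; exists C.
  have KcP : stable f g (closure (P x)).
    apply: small_forward_stable.
      split; [by exists x; exact: subset_closure| |exact: connected_closure].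
      exact: subclosed_compact (@closed_closure _ _) cptX _.
    move=> j; apply: iter_small_closure => //.
    by apply: iter_small_le (sP j x); move: e0 ec; lra.
  suff -> : P x = closure (P x) by [].
  apply/seteqP; split; first exact: subset_closure.
  move=> y Py; exists (closure (P x)); split=> //; last exact: subset_closure.
  rewrite (closure_id Y).1//; apply: closureS; exact: class_plaque_sub.
split=> //.
apply: class_decomposition => //; [exact: stable_continuum|exact: stable_setU|exact: stable_set1|].
move=> x Yx.
have [|ctL Lx LY] := @limset_plaque_continuum _ cptX hX Y P x cY Yx.
  by move=> y Yy; exact: (class_plaque_connected stable_continuum stable_set1 Yy (KP y Yy)).
move=> z Lz; exists (limset (within Y (nbhs x)) P); split=> //.
apply: small_forward_stable => // j.
(* Each point of a nearby plaque is within [2 * e] of the orbit of [x]: [e] for the plaque and [e]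
   for its base point. This is why [4 * e <= c] is required. *)
apply: (@iter_small_le _ _ f j (2 * e + 2 * e)); first by move: ec; lra.
apply: (@iter_small_center _ _ f j (2 * e) x).
apply: (limset_sub_closed (closed_mdist_le (iter j f x) (2 * e) (continuous_iter j cf))).
rewrite near_withinE.
apply: filterS (near_mdist_comp x (continuous_iter j cf) e0) => y xy Yy u Pu /=.
have Py : P y y := class_plaque_refl stable_set1 Yy.
have := sP j y y u Py Pu.
by have := metric_triangle (iter j f x) (iter j f y) (iter j f u); lra.
Qed.

(** A ball at time [n] pulled back to time 0: the ball is small enough for [small_stable_domain],
    and every stable continuum through [x] lies in one of these countably many charts. *)
Definition stable_chart n x : set X :=
  iter n g @` [set y | mdist (iter n f x) y < gam / 2].

Lemma stable_chart_center n x : stable_chart n x x.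
Proof. by exists (iter n f x); [rewrite /= mdistxx; move: gam0; lra|rewrite (iter_can fK)]. Qed.

Lemma stable_chart_domain n x : stable_domain f g (stable_chart n x).
Proof.
apply: (@class_domain_homeo _ _ (iter n g) (iter n f)).
- exact: continuous_iter.
- exact: continuous_iter.
- exact: iter_can.
- exact: iter_can.
- exact: stable_iter_inv.
- exact: stable_iter.
apply: small_stable_domain.
  by apply: (@open_mdist_lt _ _ id) => y; exact: cvg_id.
apply: (@iter_small_le _ _ f 0 (gam / 2 + gam / 2)); first by move: gam0; lra.
by apply: (@iter_small_center _ _ f 0 (gam / 2) (iter n f x)) => y /= /ltW.
Qed.

Lemma stable_chart_absorb C x : stable f g C -> C x ->
  exists n, C `<=` stable_chart n x.
Proof.
have gam4 : 0 < gam / 4 by move: gam0; lra.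
move=> /stableP[_ H] Cx; have [N NP] := H _ gam4.
exists N => y Cy; exists (iter N f y); last by rewrite (iter_can fK).
by have := NP N (leqnn N) x y Cx Cy; move: gam0; rewrite /=; lra.
Qed.

Lemma stable_absorb C x : stable f g C -> C x ->
  exists2 U, stable_domain f g U & C `<=` U.
Proof.
move=> KC Cx; have [n Cn] := stable_chart_absorb KC Cx.
by exists (stable_chart n x) => //; exact: stable_chart_domain.
Qed.

Lemma stable_leaf x :
  leaf (stable_domain f g) (stable_plaque f g) x = stable_plaque f g setT x.
Proof.
exact: (class_leaf stable_continuum stable_setU stable_absorb).
Qed.

Lemma stable_complete_basis : complete_basis (stable_domain f g).
Proof.
apply: (class_domain_basis cptX (@metric_hausdorff R X) stable_continuum stable_sub
  stable_setU stable_set1).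
by move=> x; exact: (class_domain_cover stable_set1 stable_absorb).
Qed.

Lemma stable_maximal_atlas :
  maximal_atlas (stable f g) (stable_domain f g) (stable_plaque f g).
Proof.
exact: (class_maximal_atlas cptX (@metric_hausdorff R X) stable_continuum stable_sub
  stable_set1 stable_absorb).
Qed.

Definition chart_plaque n x : set X :=
  monotone_restriction (stable_plaque f g (closure (stable_chart n x))) (stable_chart n x) x.

Definition chart_continuum n x : set X :=
  stable_plaque f g (closure (stable_chart n x)) x.

Lemma chart_plaque_open n x :
  open_plaque (stable_domain f g) (stable_plaque f g) (chart_plaque n x).
Proof.
exists (stable_chart n x), x; split=> //; first exact: stable_chart_domain.
exact: stable_chart_center.
Qed.

Lemma chart_plaque_sub n x : chart_plaque n x `<=` chart_continuum n x.
Proof. by move=> y /connected_component_sub[]. Qed.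

Lemma chart_continuum_stable n x : stable f g (chart_continuum n x).
Proof.
have [_ _] := stable_chart_domain n x; apply; apply: subset_closure.
exact: stable_chart_center.
Qed.

Lemma leaf_chart_plaques x :
  leaf (stable_domain f g) (stable_plaque f g) x = \bigcup_n chart_plaque n x.
Proof.
rewrite stable_leaf; apply/seteqP; split=> y.
  move=> [C [KC _ Cx Cy]]; have [n Cn] := stable_chart_absorb KC Cx; exists n => //.
  exact: (class_sub_open_plaque stable_continuum KC Cn Cx).
move=> [n _ /chart_plaque_sub ny]; exists (chart_continuum n x); split=> //.
  exact: chart_continuum_stable.
apply: (class_plaque_refl stable_set1); apply: subset_closure; exact: stable_chart_center.
Qed.

(** * Size of the leaves *)

Hypotheses (lcX : locally_connected X) (conX : connected [set: X]).
Hypothesis (ntX : exists x y : X, x != y).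

(** For large [N], [f^N] would carry a nonempty interior to an open set whose forward iterates are
    all [e]-small, which [no_stable_open_set] excludes. *)
Lemma stable_interior0 C : stable f g C -> (closure C)° = set0.
Proof.
move=> KC; have [[_ cptC _] _] := KC.
rewrite -(closure_id C).1; last by apply: compact_closed => //; exact: metric_hausdorff.
rewrite -subset0 => z Cz; move/stableP : KC => [_ H]; have [N NP] := H _ e0.
have oN : open (iter N f @` C°).
  apply: (@open_homeo _ (iter N f) (iter N g)); [exact: continuous_iter| | |exact: open_interior].
    exact: iter_can.
  exact: iter_can.
have e2 : 2 * e <= c by move: e0 ec; lra.
apply: (no_stable_open_set cptX lcX cf cg fK gK fwin conX ntX e0 e2 oN).
  by exists (iter N f z), z.
move=> j; apply/iter_small_image; apply: iter_smallS (NP _ (leq_addl _ _)).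
exact: interior_subset.
Qed.

Variable r : R.
Hypotheses (r0 : 0 < r) (large : forall x, exists C, [/\ continuum C, C x,
    (forall j, iter_small f j e C) & exists2 u, C u & r <= mdist x u]).

Lemma leaf_large x : exists2 u, stable_plaque f g setT x u & r <= mdist x u.
Proof.
have [C [ctC Cx sC [u Cu ur]]] := large x; exists u => //; exists C; split=> //.
by apply: small_forward_stable => // j; apply: iter_small_le (sC j); move: e0 ec; lra.
Qed.

Lemma stable_cw_atlas : cw_atlas (stable_domain f g) (stable_plaque f g).
Proof.
split.
- by case: stable_maximal_atlas.
- move=> x; exists (range (chart_plaque ^~ x)); split.
  + exact: card_image_le.
  + by move=> _ [n _ <-]; exact: chart_plaque_open.
  + by rewrite leaf_chart_plaques bigcup_image.
- move=> x; exists (chart_continuum ^~ x); split.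
    by move=> n; apply: stable_interior0; exact: chart_continuum_stable.
  by rewrite leaf_chart_plaques; apply: subset_bigcup => n _; exact: chart_plaque_sub.
- exists r => // x; have [u xu ur] := leaf_large x.
  apply: le_trans ur _; apply: le_diam => //; rewrite stable_leaf //.
  exact: (class_plaque_refl stable_set1).
Qed.

(* A plaque-compact leaf would lie in a single stable continuum, and its forward
   iterates would be leaves of arbitrarily small diameter. *)
Lemma stable_leaf_noncompact x :
  ~ plaque_compact (stable_domain f g) (stable_plaque f g)
      (leaf (stable_domain f g) (stable_plaque f g) x).
Proof.
move=> cptL; have [at_ _ _] := stable_maximal_atlas.
have [|N LN] := plaque_compact_cover at_ stable_complete_basis cptL (chart_plaque_open ^~ x).
  by rewrite leaf_chart_plaques.
(* The stable continua containing the finitely many plaques all pass through [x], so their union is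
   a stable continuum. *)
have [C [KC Cx CN]] : exists C, [/\ stable f g C, C x &
    forall n, (n <= N)%N -> chart_continuum n x `<=` C].
  have cx n : chart_continuum n x x.
    apply: (class_plaque_refl stable_set1); apply: subset_closure; exact: stable_chart_center.
  elim: (N) => [|M [C [KC Cx CM]]].
    exists (chart_continuum 0 x); split=> //; first exact: chart_continuum_stable.
    by move=> n; rewrite leqn0 => /eqP ->.
  exists (C `|` chart_continuum M.+1 x); split; [|by left|].
    by apply: stable_setU => //; [exact: chart_continuum_stable|exists x].
  move=> n; rewrite leq_eqVlt => /orP[/eqP -> y|/CM nC y /nC]; by [right|left].
have r2 : 0 < r / 2 by move: r0; lra.
move/stableP : (KC) => [_ H]; have [m mP] := H _ r2.
(* Pulled back by [g^m], the point [u] falls in the leaf of [x], hence in [C]; but [u] is at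
   distance at least [r] from [f^m x], while [f^m] makes [C] [r / 2]-small. *)
have [u [D [KD _ Dx Du]] ur] := leaf_large (iter m f x).
have : stable_plaque f g setT x (iter m g u).
  exists (iter m g @` D); split=> //; first exact: stable_iter_inv.
  by exists (iter m f x) => //; rewrite (iter_can fK).
rewrite -stable_leaf => /LN[n nN /chart_plaque_sub/(CN n nN) Cu].
have := mP m (leqnn m) _ _ Cx Cu; rewrite (iter_can gK).
by move: r0; lra.
Qed.

End stable_class.

(** * The stable and unstable foliations *)

Lemma stable_cw_foliation (R : realType) (X : metricType R) (f g : X -> X) :
  peano_continuum X -> (exists x y : X, x != y) -> homeomorphism f g ->
  cw_expansive f g ->
  [/\ complete_basis (stable_domain f g),
      cw_foliation (stable f g) (stable_domain f g) (stable_plaque f g),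
      invariant_atlas f g (stable_domain f g) (stable_plaque f g)
    & forall x : X,
        ~ plaque_compact (stable_domain f g) (stable_plaque f g)
            (leaf (stable_domain f g) (stable_plaque f g) x)].
Proof.
move=> [[_ cptX conX] lcX] ntX [cf cg fK gK] cwf.
have [delta delta0 fcw] := cwf.
(* The constant [c] is [delta / 3], so that [2 * c < delta]. Contraction for [f] yields the charts,
   contraction for [g] the large stable continua. *)
have fwin : window_contracting f (delta / 3).
  by apply: (cw_window_contracting cptX cf cg fK _ _ fcw); lra.
have gwin : window_contracting g (delta / 3).
  have [delta' _ _] := cw_expansive_sym cwf.
  apply: (@cw_window_contracting _ _ g f delta) => //; try lra.
  move=> A A0 cA sA; apply: fcw => // n.
  by have := sA (- n); rewrite iterzN opprK.
pose e : R := delta / 12; have e0 : 0 < e by rewrite /e; lra.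
have e4 : 4 * e <= delta / 3 by rewrite /e; lra.
have e2 : 2 * e <= delta / 3 by lra.
have [gam gam0 ctl] := ends_control_exists cptX lcX cf cg fK fwin e0 e2.
have [r r0 large] := large_stable_continua cptX lcX conX ntX cf cg fK gK gwin e0 e2.
split.
- exact: (stable_complete_basis cptX fK gK cf cg e0 e4 gam0 fwin ctl).
- split.
    exact: (stable_cw_atlas cptX fK gK cf cg e0 e4 gam0 fwin ctl lcX conX ntX r0 large).
  exact: (stable_maximal_atlas cptX fK gK cf cg e0 e4 gam0 fwin ctl).
- exact: stable_invariant.
- exact: (stable_leaf_noncompact cptX fK gK cf cg e0 e4 gam0 fwin ctl r0 large).
Qed.

Theorem theorem5p1p2 (R : realType) (X : metricType R) (f g : X -> X)
    (peanoX : peano_continuum X)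
    (nondegenerateX : exists x y : X, x != y)
    (homeof : homeomorphism f g)
    (cwf : cw_expansive f g) :
  [/\ complete_basis (stable_domain f g),
      cw_foliation (stable f g) (stable_domain f g) (stable_plaque f g),
      invariant_atlas f g (stable_domain f g) (stable_plaque f g)
    & forall x : X,
        ~ plaque_compact (stable_domain f g) (stable_plaque f g)
            (leaf (stable_domain f g) (stable_plaque f g) x)] /\
  [/\ complete_basis (unstable_domain f g),
      cw_foliation (unstable f g) (unstable_domain f g) (unstable_plaque f g),
      invariant_atlas f g (unstable_domain f g) (unstable_plaque f g)
    & forall x : X,
        ~ plaque_compact (unstable_domain f g) (unstable_plaque f g)
            (leaf (unstable_domain f g) (unstable_plaque f g) x)].
Proof.
split; first exact: stable_cw_foliation.
have homeog : homeomorphism g f by case: homeof.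
have [cb fol inv ncpt] :=
  stable_cw_foliation peanoX nondegenerateX homeog (cw_expansive_sym cwf).
rewrite /unstable_domain /unstable_plaque unstableE; split; [exact: cb|exact: fol| |exact: ncpt].
(* Exchanging [f] and [g] changes [n] into [- n], and invariance ranges over all integers. *)
by move=> n U dU; have := inv (- n) U dU; rewrite iterzN opprK.
Qed.
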